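(* The eigenvalues of the one-sided transposition shuffle $\mathrm{OST}_n$ are labelled by standard Young tableaux of size $n$, and the eigenvalue represented by a tableau of shape $\lambda$ appears $d_\lambda$ times, where $d_\lambda$ is the dimension of $\lambda$. For a standard Young tableau $T$ of shape $\lambda\vdash n$ the eigenvalue corresponding to $T$ is $$\mathrm{eig}(T)=\frac1n\sum_{(i,j)\in T}\frac{j-i+1}{T(i,j)},$$ where the sum is over all boxes $(i,j)$ of $T$. (That is, the multiset of the $n!$ eigenvalues of the transition matrix of $\mathrm{OST}_n$ consists of the numbers $\mathrm{eig}(T)$, one for each pair of a partition $\lambda\vdash n$ and a standard Young tableau $T$ of shape $\lambda$, each repeated $d_\lambda$ times.)
   Context: $\mathrm{OST}_n$ is the probability distribution on $S_n$ with $\mathrm{OST}_n((i\,j))=\frac{1}{nj}$ for $1\le i\le j\le n$ (each $(i\,i)$ being the identity, so the identity has mass $H_n/n$, $H_n=\sum_{k=1}^n 1/k$), and $0$ elsewhere. Its transition matrix is $P(g,h)=\mathrm{OST}_n(hg^{-1})$ for $g,h\in S_n$. A partition $\lambda\vdash n$ is identified with its Young diagram, rows numbered downwards; box $(i,j)$ is in row $i$, column $j$. A standard Young tableau $T$ of shape $\lambda$ is a filling of the boxes by $1,\dots,n$, each used once, increasing along rows and down columns; $T(i,j)$ is the entry in box $(i,j)$. $d_\lambda$ is the number of standard Young tableaux of shape $\lambda$. *)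

(* Defs.v *)
From HB Require Import structures.
From mathcomp Require Import all_boot all_order all_algebra all_fingroup.
Set Implicit Arguments.
Unset Strict Implicit.
Unset Printing Implicit Defensive.
Import Order.TTheory GRing.Theory Num.Theory.
Local Open Scope ring_scope.

(* Indices in 'I_n are 0-based: k : 'I_n stands for k.+1 in {1, ..., n}.      *)

(* Mass at s of the law of the transposition (i j), where the pair i <= j has *)
(* probability 1 / (n j). Every pair (i, i) contributes to the identity.      *)
Definition OST (R : numFieldType) (n : nat) (s : 'S_n) : R :=
  \sum_(i < n) \sum_(j < n | (i <= j)%N && (tperm i j == s))
     (n%:R * j.+1%:R)^-1.

(* The product of 'S_n applies its left factor first, so the composite        *)
(* h o g^-1, usually written h g^-1, is (g^-1 * h)%g.                         *)
Definition OST_trans (R : numFieldType) (n : nat) (g h : 'S_n) : R :=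
  OST R (g^-1 * h)%g.

Definition OST_mx (R : numFieldType) (n : nat) : 'M[R]_#|{: 'S_n}| :=
  \matrix_(a, b) OST_trans R (enum_val a) (enum_val b).

(* Partitions of n are padded with zeros to exactly n parts.                  *)
Definition is_intpart (n : nat) (l : {ffun 'I_n -> 'I_n.+1}) : bool :=
  [forall i : 'I_n, forall j : 'I_n, (i <= j)%N ==> (l j <= l i)%N]
  && (\sum_(i < n) (l i : nat) == n)%N.

Definition intpart (n : nat) : Type :=
  {l : {ffun 'I_n -> 'I_n.+1} | is_intpart l}.

(* Boxes (row, column) of the Young diagram; no column index exceeds n.       *)
Definition box (n : nat) (la : intpart n) : Type :=
  {b : 'I_n * 'I_n | (b.2 < val la b.1)%N}.

Definition box_row n (la : intpart n) (b : box la) : 'I_n := (val b).1.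
Definition box_col n (la : intpart n) (b : box la) : 'I_n := (val b).2.

Definition is_syt (n : nat) (la : intpart n) (T : {ffun box la -> 'I_n}) :=
  [&& [forall k : 'I_n, #|[set b | T b == k]| == 1%N],
      [forall b, forall c, (box_row b == box_row c) ==>
         (box_col b < box_col c)%N ==> (T b < T c)%N]
    & [forall b, forall c, (box_col b == box_col c) ==>
         (box_row b < box_row c)%N ==> (T b < T c)%N]].

Definition syt (n : nat) (la : intpart n) : Type :=
  {T : {ffun box la -> 'I_n} | is_syt T}.

Definition dim_part (n : nat) (la : intpart n) : nat := #|{: syt la}|.

Definition eig (R : numFieldType) (n : nat) (la : intpart n) (T : syt la) : R :=
  n%:R^-1 * \sum_(b : box la)
     ((box_col b)%:R - (box_row b)%:R + 1) / (val T b).+1%:R.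

(* Main.v *)
(* The mass function makes OST = (1/n) sum_k (1 + J_k) / (k+1) in the right
   regular representation, where J_k = sum_{i<k} (i k) are the Jucys-Murphy
   elements (0-based). These commute and are symmetric, so they are diagonalised
   simultaneously, J_k = diag(c_k), and it remains to count, for each sequence of
   scalars, the indices a with (c_0 a, ..., c_{n-1} a) equal to that sequence.
   Let E_k project the group algebra onto the span of the permutations fixing all
   points >= k. From s J_{k+1} = J_k s + 1 with s = (k k+1), one gets, for
   R_k = (z - J_k)^-1, the recursion
     R_{k+1} (1 - R_k^2) = s R_k s + R_k s R_k,
   hence E_k R_k = z^-1 prod_{i<k} (z - J_i)^2 / ((z - J_i)^2 - 1). On an eigenvector
   where c_0, ..., c_{k-1} are the contents of a standard tableau of shape la this
   telescopes to a rational function of z whose simple poles are the contents of the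
   addable boxes of la (its residues are Kerov's transition probabilities). So
   the next eigenvalue is the content of an addable box, with relative multiplicity
   the residue, and the residues are (number of tableaux of mu) / ((k+1) * number of
   tableaux of la): this follows from the partial fractions of the inverse function
   and from the exchange relation for adding two boxes in either order. *)

Require Import Defs.
From HB Require Import structures.
From mathcomp Require Import all_boot all_order all_algebra all_fingroup.
From mathcomp Require Import all_field mxred spectral.
From mathcomp Require Import zify ring.
Set Implicit Arguments.
Unset Strict Implicit.
Unset Printing Implicit Defensive.
Import Order.TTheory GRing.Theory Num.Theory.
Local Open Scope ring_scope.

(** * Partial fractions *)

Section PartialFractions.
Variable K : numFieldType.
Implicit Types (x : nat -> K) (p : {poly K}).

Lemma lagrange_interp x m p : injective x -> (size p <= m)%N ->
  p = \sum_(i < m) (p.[x i] / \prod_(j < m | j != i) (x i - x j)) *: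
        \prod_(j < m | j != i) ('X - (x j)%:P).
Proof.
case: m => [|m] x_inj sp.
  by rewrite big_ord0; apply/eqP; rewrite -size_poly_eq0 -leqn0.
rewrite {1}(lagrange_gen (ltn0Sn m) x_inj sp); apply: eq_bigr => i _.
rewrite lagrangeE //= mulrA -polyCM mul_polyC; congr ((_ * _) *: _).
by rewrite horner_prod; congr (_^-1); apply: eq_bigr => j _; rewrite hornerXsubC.
Qed.

(** Partial fractions with simple poles: dividing term [i] of the interpolation formula by the full
    product leaves only the factor [z - x i] below. *)
Lemma lagrange_eval x m p z : injective x -> (size p <= m)%N ->
  (forall i : 'I_m, z != x i) ->
  p.[z] / \prod_(i < m) (z - x i) =
  \sum_(i < m) (p.[x i] / \prod_(j < m | j != i) (x i - x j)) / (z - x i).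
Proof.
move=> x_inj sp zx; rewrite {1}(lagrange_interp x_inj sp) horner_sum mulr_suml.
apply: eq_bigr => i _; rewrite hornerZ -!mulrA; congr (_ * (_ * _)).
rewrite horner_prod [X in _ / X](bigD1 i) //= invfM mulrCA.
under eq_bigr do rewrite hornerXsubC.
by rewrite mulfV ?mulr1 //; apply/prodf_neq0 => j _; rewrite subr_eq0.
Qed.

Local Notation F x m := (\prod_(k < m) ('X - (x k)%:P)).

Lemma coef_prodX x m : (F x m)`_m = 1.
Proof.
have := monic_prod_XsubC (index_enum 'I_m) predT x.
by move/monicP; rewrite lead_coefE size_prod_XsubC /= /index_enum -enumT size_enum_ord.
Qed.

Lemma coef_prodX_gt x m j : (m < j)%N -> (F x m)`_j = 0.
Proof.
move=> mj; rewrite nth_default //.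
by rewrite size_prod_XsubC /= /index_enum -enumT size_enum_ord.
Qed.

Lemma coef_mulX_prodX x m : ('X * F x m)`_m = - \sum_(k < m) x k.
Proof.
elim: m => [|m IH]; first by rewrite !big_ord0 mulr1 coefX oppr0.
rewrite !big_ord_recr /= mulrA mulrBr coefB coefMX /= IH coefMC coefXM /=.
by rewrite coef_prodX mul1r opprD.
Qed.

(** Shifting every node by 1 turns F(t) into F(t - 1), so this is the difference F(t - 1) - F(t):
    the terms of degree [m] cancel, and at a node only the shifted product survives. *)
Let D x m := F (fun k => x k + 1) m - F x m.

Lemma prodX_diffS x m : D x m.+1 = D x m * ('X - (x m)%:P) - F (fun k => x k + 1) m.
Proof. by rewrite /D !big_ord_recr /= polyCD; ring. Qed.

(** The factor ['X] shifts indices, so that the coefficient of degree [m - 1] is named without a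
    predecessor and the case [m = 0] stays true. *)
Lemma coef_mulX_diff x m : ('X * D x m)`_m = - m%:R.
Proof.
elim: m => [|m IH]; first by rewrite /D !big_ord0 subrr mulr0 coef0 oppr0.
rewrite prodX_diffS mulrBr mulrA mulrBr !coefB coefMX /= IH coefMC !coefXM /=.
by rewrite /D coefB (coef_prodX (fun k => x k + 1)) coef_prodX -natr1; ring.
Qed.

Lemma coef_mulX2_diff x m :
  ('X * ('X * D x m))`_m = m.-1%:R * \sum_(k < m) x k + 'C(m, 2)%:R.
Proof.
elim: m => [|m IH]; first by rewrite /D !big_ord0 subrr !mulr0 coef0 add0r.
have -> : 'X * ('X * D x m.+1) = 'X * ('X * D x m) * 'X
    - 'X * ('X * D x m) * (x m)%:P - 'X * ('X * F (fun k => x k + 1) m).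
  by rewrite prodX_diffS; ring.
rewrite !coefB coefMX coefMC /= IH [('X * (_ * D x m))`_m.+1]coefXM /=.
rewrite coef_mulX_diff coefXM /= (coef_mulX_prodX (fun k => x k + 1)).
rewrite big_ord_recr /= big_split /= sumr_const card_ord.
rewrite binS bin1 natrD.
case: m {IH} => [|m] /=; first by rewrite big_ord0; ring.
by rewrite -[m.+1%:R]natr1; ring.
Qed.

Lemma lagrange_coef x m p : injective x -> (size p <= m.+1)%N ->
  p`_m = \sum_(i < m.+1) p.[x i] / \prod_(j < m.+1 | j != i) (x i - x j).
Proof.
move=> x_inj sp; rewrite {1}(lagrange_interp x_inj sp) coef_sum.
apply: eq_bigr => i _; rewrite coefZ -[RHS]mulr1; congr (_ * _).
have q_monic : \prod_(j < m.+1 | j != i) ('X - (x j)%:P) \is monic.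
  by apply: monic_prod => j _; rewrite monicXsubC.
move/monicP: q_monic; rewrite lead_coefE => <-; congr (_`_ _).
rewrite -big_filter size_prod_XsubC /=.
by have [e _ _ [_ ->]] := big_enumP (fun j => j != i); rewrite cardC1 card_ord.
Qed.

Let prod_shift x m (i : 'I_m) :
  (D x m).[x i] = - \prod_(k < m | k != i) (x i - x k - 1).
Proof.
rewrite /D hornerD hornerN !horner_prod (bigD1 i) //= [X in _ - X](bigD1 i) //=.
rewrite !hornerXsubC subrr mul0r subr0 opprD addNKr mulN1r; congr (- _).
by apply: eq_bigr => k _; rewrite hornerXsubC; ring.
Qed.

Let size_diff x m : (size (D x m) <= m)%N.
Proof.
apply/leq_sizeP => j; rewrite leq_eqVlt => /predU1P[<-|mj]; rewrite coefB.
  by rewrite (coef_prodX (fun k => x k + 1)) coef_prodX subrr.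
by rewrite (coef_prodX_gt (fun k => x k + 1)) // coef_prodX_gt // subrr.
Qed.

(** Interpolation of [D x m] at the nodes, compared in degree [m - 1]: that coefficient is [- m],
    and each value is minus the numerator of a quotient. *)
Lemma sum_shift_quotient x m : injective x ->
  \sum_(i < m) \prod_(k < m | k != i) ((x i - x k - 1) / (x i - x k)) = m%:R.
Proof.
case: m => [|m] x_inj; first by rewrite big_ord0.
have := lagrange_coef x_inj (size_diff x m.+1).
have := coef_mulX_diff x m.+1; rewrite coefXM /= => -> /eqP.
rewrite eqr_oppLR => /eqP ->; rewrite -sumrN; apply: eq_bigr => i _.
by rewrite prod_shift prodf_div mulNr opprK.
Qed.

Lemma sum_shift_quotient_mul x m : injective x ->
  \sum_(i < m) x i * \prod_(k < m | k != i) ((x i - x k - 1) / (x i - x k)) =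
  \sum_(i < m) x i - 'C(m, 2)%:R.
Proof.
case: m => [|m] x_inj; first by rewrite !big_ord0 subr0.
(* The degree of ['X * D] is too high for [m.+1] nodes; the multiple of [F] cancels its top
   coefficient and vanishes at every node. *)
pose P := 'X * D x m.+1 + m.+1%:R *: F x m.+1.
have sP : (size P <= m.+1)%N.
  apply/leq_sizeP => j; rewrite leq_eqVlt => /predU1P[<-|mj]; rewrite coefD coefZ.
    by rewrite coef_mulX_diff coef_prodX mulr1 addNr.
  rewrite coef_prodX_gt // mulr0 addr0 coefXM; case: j mj => //= j mj.
  exact: (leq_sizeP _ _ (size_diff x m.+1)).
have := lagrange_coef x_inj sP.
have -> : P`_m = - (\sum_(k < m.+1) x k - 'C(m.+1, 2)%:R).
  have -> : P`_m = ('X * P)`_m.+1 by rewrite coefXM.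
  rewrite mulrDr coefD -scalerAr coefZ coef_mulX2_diff coef_mulX_prodX.
  by rewrite -[m.+1%:R]natr1 /=; ring.
move/eqP; rewrite eqr_oppLR => /eqP ->; rewrite -sumrN; apply: eq_bigr => i _.
rewrite /P hornerD hornerZ hornerM hornerX prod_shift prodf_div.
suff -> : (F x m.+1).[x i] = 0 by ring.
by rewrite horner_prod (bigD1 i) //= hornerXsubC subrr mul0r.
Qed.

(** Multiplying by the factors ['X - b] makes [p] vanish at the excluded points too; in
    characteristic 0 the natural numbers then give more roots than the degree allows. *)
Lemma poly_eq0_cofinite (B : seq K) p : (forall z, z \notin B -> root p z) -> p = 0.
Proof.
move=> pB; apply/eqP; apply: contraT => p_neq0.
pose q := p * \prod_(b <- B) ('X - b%:P).
have q_neq0 : q != 0 by rewrite mulf_neq0 // monic_neq0 ?monic_prod_XsubC.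
have := @max_poly_roots _ q [seq i%:R | i <- iota 0 (size q)] q_neq0.
rewrite size_map size_iota ltnn => -> //.
  apply/allP => z _; rewrite rootM root_prod_XsubC.
  by have [zB|/pB->//] := boolP (z \in B); rewrite orbT.
by rewrite map_inj_uniq ?iota_uniq // => i j /eqP; rewrite eqr_nat => /eqP.
Qed.

(** Poles may coincide, so only the total coefficient at each pole is determined. Clearing
    denominators over the distinct poles gives a polynomial that is 0; its value at a pole [y] is a
    nonzero multiple of the coefficient at [y]. *)
Lemma pfrac_unique (I : finType) (x a : I -> K) (B : seq K) :
  (forall z, z \notin B -> \sum_i a i / (z - x i) = 0) ->
  forall y, \sum_(i | x i == y) a i = 0.
Proof.
move=> H y; pose X := undup (codom x).
pose p := \sum_i a i *: \prod_(t <- rem (x i) X) ('X - t%:P).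
have Xx i : x i \in X by rewrite mem_undup codom_f.
have p0 : p = 0.
  apply: (@poly_eq0_cofinite (B ++ X)) => z; rewrite mem_cat => /norP[/H Hz zX].
  rewrite /root; suff -> : p.[z] = \prod_(t <- X) (z - t) * \sum_i a i / (z - x i).
    by rewrite Hz mulr0.
  rewrite horner_sum mulr_sumr; apply: eq_bigr => i _.
  rewrite hornerZ horner_prod [in RHS](big_rem (x i)) //= mulrCA; congr (_ * _).
  rewrite mulrAC mulfV ?mul1r.
    by apply: eq_bigr => t _; rewrite hornerXsubC.
  by rewrite subr_eq0; apply: contraNneq zX => ->.
have [yX|yX] := boolP (y \in X); last first.
  by apply: big_pred0 => i; apply: contraNF yX => /eqP <-.
have c_neq0 : \prod_(t <- rem y X) (y - t) != 0.
  rewrite prodf_seq_neq0; apply/allP => t; rewrite mem_rem_uniq ?undup_uniq //.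
  by case/andP => ty _ /=; rewrite subr_eq0 eq_sym.
apply: (mulIf c_neq0); rewrite mul0r -[RHS](horner0 y) -p0 /p horner_sum.
rewrite mulr_suml [RHS](bigID (fun i => x i == y)) /= [X in _ + X]big1 ?addr0.
  apply: eq_bigr => i /eqP ->; rewrite hornerZ horner_prod.
  by congr (_ * _); apply: eq_bigr => t _; rewrite hornerXsubC.
move=> i xy; rewrite hornerZ horner_prod (big_rem y) /=.
  by rewrite hornerXsubC subrr mul0r mulr0.
by rewrite mem_rem_uniq ?undup_uniq // inE eq_sym xy.
Qed.

End PartialFractions.

(** * Lattice words *)

Section LatticeWords.
Implicit Types (w u : seq nat) (i j m k : nat).

(* Row 0 is compared with itself, as [0.-1 = 0]. *)
Definition ispart w := all (fun j => count_mem j w <= count_mem j.-1 w)%N w.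

(* Words list the rows of the entries of a tableau, from the largest entry to the smallest;
   row [i] then has length [count_mem i w]. *)
Fixpoint lattice w := if w is i :: u then ispart w && lattice u else true.

Fixpoint lwords m k :=
  if k is k'.+1 then
    [seq w <- [seq i :: u | i <- iota 0 m, u <- lwords m k'] | ispart w]
  else [:: [::]].

(** A word stands for the shape whose row lengths are its letter counts. If this is a partition and
    the letters are below [m], the value is the number of standard tableaux of that shape. *)
Definition nlattice m w := count (perm_eq w) (lwords m (size w)).

Lemma ispartP w : reflect (forall i, count_mem i.+1 w <= count_mem i w)%N (ispart w).
Proof.
apply: (iffP allP) => [H i|H [|j] //].
by have [/H//|/count_memPn ->] := boolP (i.+1 \in w).
Qed.

Lemma ispart_mono w i j : ispart w -> (i <= j)%N -> (count_mem j w <= count_mem i w)%N.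
Proof.
move/ispartP => H /subnK <-; elim: (j - i)%N => //= d IH.
by rewrite addSn (leq_trans (H _)).
Qed.

Lemma perm_ispart w u : perm_eq w u -> ispart w = ispart u.
Proof.
move/seq.permP => E; apply/ispartP/ispartP => H i; first by rewrite -!E.
by rewrite !E.
Qed.

Lemma lattice_ispart w : lattice w -> ispart w.
Proof. by case: w => //= i u /andP[]. Qed.

(** A nonempty row [m] forces rows [0] to [m] to be nonempty, hence at least [m.+1] letters. *)
Lemma ispart_size w m : ispart w -> (size w <= m)%N -> m \notin w.
Proof.
move=> wp; apply: contraL => mw; rewrite -ltnNge.
rewrite -[m.+1](size_iota 0); apply: uniq_leq_size (iota_uniq _ _) _ => i.
rewrite mem_iota add0n ltnS => /(ispart_mono wp).
by apply: contraTT => /count_memPn ->; rewrite -ltnNge -has_count has_pred1.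
Qed.

Lemma ispart_cons u i : ispart u ->
  ispart (i :: u) = (i == 0%N) || (count_mem i u < count_mem i.-1 u)%N.
Proof.
move=> /ispartP up; apply/ispartP/idP => [|H j].
  case: i => // i /(_ i) /=; rewrite eqxx; lia.
by have := up j; case: i H => [|i] /=; [|have [->|] := eqVneq i j]; lia.
Qed.

Lemma ispart_rem w i : ispart w -> i \in w ->
  ispart (rem i w) = (count_mem i.+1 w < count_mem i w)%N.
Proof.
move=> /ispartP wp iw; have /seq.permP E := perm_to_rem iw.
apply/ispartP/idP => [/(_ i)|H j].
  by have := E (pred1 i); have := E (pred1 i.+1); rewrite /=; lia.
have := wp j; rewrite !E /=.
have [ij|ij] := eqVneq i j.
  by subst j; move: H; rewrite !E /=; lia.
by lia.
Qed.

Lemma mem_lwords m k w :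
  (w \in lwords m k) = [&& size w == k, all (ltn^~ m) w & lattice w].
Proof.
elim: k w => [|k IH] [|i u]; rewrite ?inE //= mem_filter.
  by apply/andP => -[_ /allpairsP[[? ?] []]].
have -> : (i :: u \in [seq i0 :: u0 | i0 <- iota 0 m, u0 <- lwords m k]) =
   (i < m)%N && (u \in lwords m k).
  apply/allpairsP/andP => [[[i' u'] /= [+ ? [-> ->]]]|[im uk]].
    by rewrite mem_iota.
  by exists (i, u); rewrite mem_iota.
by rewrite IH eqSS; case: (_ < m)%N => //=; case: (ispart _) => //=; rewrite ?andbF.
Qed.

Lemma lwords_uniq m k : uniq (lwords m k).
Proof.
elim: k => //= k IH; apply/filter_uniq/allpairs_uniq; rewrite ?iota_uniq //.
by move=> [i u] [j v] _ _ [-> ->].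
Qed.

Lemma perm_nlattice m w u : perm_eq w u -> nlattice m w = nlattice m u.
Proof.
move=> wu; rewrite /nlattice (perm_size wu); apply: eq_count => v.
by rewrite (permPl wu).
Qed.

Lemma nlattice_eq0 m w : ~~ ispart w -> nlattice m w = 0%N.
Proof.
move=> wp; apply/eqP; rewrite -leqn0 leqNgt -has_count; apply: contra wp.
case/hasP => u; rewrite mem_lwords => /and3P[_ _ /lattice_ispart up].
by move=> /perm_ispart ->.
Qed.

(** Branching rule: the head of a word is the row of the largest entry, and removing it leaves a
    tableau of a smaller shape. Rows that do not end in a removable corner contribute 0 by
    [nlattice_eq0]. *)
Lemma nlattice_rec m w : ispart w -> w != [::] ->
  nlattice m w = (\sum_(i < m | (i : nat) \in w) nlattice m (rem (i : nat) w))%N.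
Proof.
move=> wp w0; have Sw : size w = (size w).-1.+1 by case: w w0 {wp}.
rewrite /nlattice Sw /= -[LHS]sum1_count big_filter_cond big_mkcond.
rewrite big_allpairs_dep /=.
rewrite -{1}[m]subn0 big_mkord [RHS]big_mkcond; apply: eq_bigr => i _.
rewrite -big_mkcond /=.
have [iw|iw] := ifP; last first.
  rewrite big1_seq // => u /andP[/andP[_ /perm_mem E] _].
  by rewrite E mem_head in iw.
rewrite -sum1_count size_rem //; apply: eq_bigl => u.
have E := perm_to_rem iw; rewrite (permPl E) perm_cons.
have [Eu|] := boolP (perm_eq (rem _ w) u); last by rewrite andbF.
by rewrite andbT -(perm_ispart (_ : perm_eq w _)) // (permPl E) perm_cons.
Qed.
End LatticeWords.

(** * Transition probabilities of the Young graph *)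

Section TransitionProbabilities.
Variable K : numFieldType.
Implicit Types (w u : seq nat) (i j m k : nat) (z : K).

(* The content of the next box of row [i]. *)
Definition rowend w i : K := (count_mem i w)%:R - i%:R.

Fixpoint contents w : seq K :=
  if w is i :: u then rowend u i :: contents u else [::].

(* The residue at [rowend w i] of the rational function in [resolvent_pfrac]; it vanishes
   when no box can be added to row [i]. *)
Definition transition m w i : K :=
  (\prod_(k < m) (rowend w i - rowend w k + 1)) /
  \prod_(k < m.+1 | k != i :> nat) (rowend w i - rowend w k).

Lemma rowend_cons i u j : rowend (i :: u) j = rowend u j + (i == j)%:R.
Proof. by rewrite /rowend /= natrD; ring. Qed.

(** Row lengths weakly decrease in [i] while [- i] strictly decreases. *)
Lemma rowend_inj w : ispart w -> injective (rowend w).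
Proof.
move=> wp i j /eqP; rewrite /rowend subr_eq addrAC eq_sym subr_eq -!natrD eqr_nat.
by move/eqP; case: (leqP i j) => [ij|/ltnW ij]; have := ispart_mono wp ij; lia.
Qed.

Lemma perm_rowend w u : perm_eq w u -> rowend w =1 rowend u.
Proof. by move=> /seq.permP E i; rewrite /rowend E. Qed.

Lemma perm_transition m w u i : perm_eq w u -> transition m w i = transition m u i.
Proof.
move=> E; rewrite /transition.
by congr (_ / _); apply: eq_bigr => k _; rewrite !(perm_rowend E).
Qed.

(** The blocked row [i] is as long as row [i - 1], so the numerator factor at [k = i - 1] is 0. *)
Lemma transition_eq0 m u i : (i <= m)%N -> ispart u -> ~~ ispart (i :: u) ->
  transition m u i = 0.
Proof.
case: i => [|i] im up; rewrite ispart_cons //= => H.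
have E : count_mem i.+1 u = count_mem i u.
  by apply/eqP; rewrite eqn_leq (ispart_mono up) // leqNgt.
rewrite /transition (bigD1 (Ordinal im)) //= /rowend E -[i.+1%:R]natr1.
by rewrite (_ : _ + 1 = 0) ?mul0r //; ring.
Qed.

(** For [k] other than [i], the numerator factor is a difference of two [rowend] values of the
    partition [i :: u], and these are distinct. *)
Lemma transition_neq0 m u i : ispart u -> ispart (i :: u) -> transition m u i != 0.
Proof.
move=> up wp; rewrite mulf_neq0 ?invr_eq0 //; last first.
  apply/prodf_neq0 => k ki; rewrite subr_eq0; apply: contra ki => /eqP/(rowend_inj up).
  by move=> ->.
apply/prodf_neq0 => k _; have [<-|ki] := eqVneq i k; first by rewrite subrr add0r oner_eq0.
have := contra_neq (@rowend_inj _ wp i k) ki; apply: contra_neq => E.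
by apply/eqP; rewrite !rowend_cons eqxx (negPf ki) addr0 -subr_eq0 addrAC; apply/eqP.
Qed.

(** Only the factors at [k = i] change: with [d] the difference of the row ends, [d + 1] becomes [d]
    in the numerator and [d] becomes [d - 1] in the denominator. *)
Lemma transition_cons m u i j : (i < m)%N -> i != j -> ispart u -> ispart (j :: u) ->
  transition m (i :: u) j = transition m u j *
    ((rowend u j - rowend u i) ^+ 2 /
     ((rowend u j - rowend u i + 1) * (rowend u j - rowend u i - 1))).
Proof.
move=> im ij up jp.
set d := rowend u j - rowend u i.
have d0 : d != 0 by rewrite subr_eq0; apply: contra_neq ij => /(rowend_inj up).
have d1 : d + 1 != 0.
  have := contra_neq (@rowend_inj _ jp i j) ij; apply: contra_neq => E.
  apply/esym/eqP; rewrite !rowend_cons eqxx [j == i]eq_sym (negPf ij) addr0.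
  by rewrite -subr_eq0 addrAC; apply/eqP.
rewrite /transition (bigD1 (Ordinal im)) //= [X in _ = X / _ * _](bigD1 (Ordinal im)) //=.
have imj : (inord i : 'I_m.+1) != j :> nat by rewrite inordK ?ltnS ?(ltnW im).
rewrite (bigD1 (inord i)) //= [X in _ = _ / X * _](bigD1 (inord i)) //=.
rewrite inordK ?ltnS ?(ltnW im) // !rowend_cons eqxx (negPf ij) addr0 -/d.
set P := \prod_(_ < m | _) _; set P' := \prod_(_ < m | _) _.
have -> : P' = P.
  apply: eq_bigr => k; rewrite -val_eqE /= eq_sym => /negPf ki.
  by rewrite !rowend_cons ki !addr0.
set Q := \prod_(_ < m.+1 | _) _; set Q' := \prod_(_ < m.+1 | _) _.
have -> : Q' = Q.
  apply: eq_bigr => k /andP[_]; rewrite -val_eqE /= inordK ?ltnS ?(ltnW im) // eq_sym.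
  move=> /negPf ki.
  by rewrite !rowend_cons ki !addr0.
have -> : rowend u j - (rowend u i + 1) = d - 1 by rewrite /d; ring.
rewrite [d - 1 + 1]subrK !invfM.
(* When [d = 1] a denominator is 0 on both sides, and both sides are 0 because the inverse of 0 is
   0. *)
have [->|e0] := eqVneq (d - 1) 0; first by rewrite invr0; ring.
have [->|Q0] := eqVneq Q 0; first by rewrite invr0; ring.
by field; rewrite d0 d1 e0 Q0.
Qed.

(** The correction factor of [transition_cons] is even in the difference of the two row ends, so it
    is the same for both orders. *)
Lemma transition_exchange m u i j : (i < m)%N -> (j < m)%N -> i != j -> ispart u ->
  ispart (i :: u) -> ispart (j :: u) ->
  transition m u i * transition m (i :: u) j =
  transition m u j * transition m (j :: u) i.
Proof.
move=> im jm ij up ip jp; rewrite transition_cons // transition_cons // 1?eq_sym //.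
set a := rowend u i; set b := rowend u j.
have -> : (a - b) ^+ 2 / ((a - b + 1) * (a - b - 1)) =
  (b - a) ^+ 2 / ((b - a + 1) * (b - a - 1)) by congr (_ / _); ring.
by rewrite mulrCA.
Qed.

Lemma rowend_nil_prod m z : (forall k, (k < m)%N -> z + k.+1%:R != 0) ->
  \prod_(k < m) (z + k.+1%:R) / \prod_(k < m.+1) (z + k%:R) = z^-1.
Proof.
move=> zm; rewrite big_ord_recl /= addr0 invfM mulrCA mulfV ?mulr1 //.
by apply/prodf_neq0 => k _; apply: zm.
Qed.

(** Telescoping: let [d] be [z] minus the content of a new box in row [i]. The box turns [d + 1]
    into [d] in the numerator and [d] into [d - 1] in the denominator, which multiplies the quotient
    by d^2 / (d^2 - 1). *)
Lemma contents_resolvent m w z : all (ltn^~ m) w ->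
    (forall k, (k < m)%N -> z + k.+1%:R != 0) ->
    {in contents w, forall c, z - c != 0 /\ z - c + 1 != 0} ->
  z^-1 * \prod_(c <- contents w) ((z - c) ^+ 2 / ((z - c) ^+ 2 - 1)) =
  \prod_(k < m) (z - rowend w k + 1) / \prod_(k < m.+1) (z - rowend w k).
Proof.
elim: w => [|i u IH] /= + zm zw.
  move=> _; rewrite big_nil mulr1 -(rowend_nil_prod zm); congr (_ / _).
    by apply: eq_bigr => k _; rewrite /rowend /= -natr1; ring.
  by apply: eq_bigr => k _; rewrite /rowend /=; ring.
case/andP => im um; have [z0 z1] := zw (rowend u i) (mem_head _ _).
rewrite big_cons mulrCA IH // => [|c cu]; last by apply: zw; rewrite inE cu orbT.
rewrite (bigD1 (Ordinal im)) //= [X in _ = X / _](bigD1 (Ordinal im)) //=.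
rewrite (bigD1 (inord i)) //= [X in _ = _ / X](bigD1 (inord i)) //= inordK ?ltnS ?(ltnW im) //.
rewrite !rowend_cons eqxx; set d := z - rowend u i in z0 z1 *.
set P := \prod_(_ < m | _) _; set P' := \prod_(_ < m | _) _.
have -> : P' = P.
  apply: eq_bigr => k; rewrite -val_eqE /= eq_sym => /negPf ki.
  by rewrite !rowend_cons ki !addr0.
set Q := \prod_(_ < m.+1 | _) _; set Q' := \prod_(_ < m.+1 | _) _.
have -> : Q' = Q.
  apply: eq_bigr => k; rewrite -val_eqE /= inordK ?ltnS ?(ltnW im) // eq_sym.
  move=> /negPf ki.
  by rewrite !rowend_cons ki !addr0.
have -> : z - (rowend u i + 1) = d - 1 by rewrite /d; ring.
have -> : d ^+ 2 - 1 = (d + 1) * (d - 1) by ring.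
rewrite [d - 1 + 1]subrK !invfM.
have [->|e0] := eqVneq (d - 1) 0; first by rewrite invr0; ring.
have [->|Q0] := eqVneq Q 0; first by rewrite invr0; ring.
by field; rewrite z0 z1 e0 Q0.
Qed.

Lemma resolvent_pfrac m w z : ispart w -> (size w < m)%N ->
    (forall k : 'I_m.+1, z != rowend w k) ->
  \prod_(k < m) (z - rowend w k + 1) / \prod_(k < m.+1) (z - rowend w k) =
  \sum_(i < m) transition m w i / (z - rowend w i).
Proof.
move=> wp wm zw; pose p := \prod_(k < m) ('X - (rowend w k - 1)%:P).
have hp y : p.[y] = \prod_(k < m) (y - rowend w k + 1).
  by rewrite horner_prod; apply: eq_bigr => k _; rewrite hornerXsubC opprB addrA addrAC.
have sp : (size p <= m.+1)%N by rewrite size_prod_XsubC /index_enum -enumT size_enum_ord.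
rewrite -hp (lagrange_eval (rowend_inj wp) sp) // big_ord_recr /=.
(* The bound on [size w] leaves rows [m - 1] and [m] empty, so no box can be added to row [m]. *)
rewrite [X in _ + X](_ : _ = 0) ?addr0; last first.
  rewrite hp -[X in X / _]/(transition m w m) transition_eq0 ?mul0r //.
  case: m wm {p hp sp zw} => // m wm; rewrite ispart_cons //=.
  by rewrite (count_memPn (ispart_size wp wm)) ltn0.
by apply: eq_bigr => i _; rewrite hp.
Qed.

End TransitionProbabilities.

(** * Transition probabilities as ratios of numbers of tableaux *)

Section Cotransition.
Variable K : numFieldType.
Implicit Types (w u : seq nat) (i j m k : nat) (z : K).

Lemma sum_count_mem m w : all (ltn^~ m) w -> (\sum_(i < m) count_mem (i : nat) w = size w)%N.
Proof.
elim: w => [|i w IH] /=; first by rewrite big1.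
case/andP => im /IH; rewrite big_split /= => ->; rewrite (bigD1 (Ordinal im)) //= eqxx.
by rewrite big1 // => k; rewrite -val_eqE eq_sym /= => /negPf ->.
Qed.

(** In terms of the row ends of [w], each summand is a product of quotients (x_i - x_k - 1) / (x_i -
    x_k) times x_i - x_m - 1. This expression is 0 at rows without a removable corner, so the sum
    extends to all rows, where the two shift-quotient identities evaluate it. *)
Lemma sum_inv_transition m w : ispart w -> all (ltn^~ m) w ->
  \sum_(i < m | ((i : nat) \in w) && ispart (rem (i : nat) w))
     (transition K m (rem (i : nat) w) i)^-1 = (size w)%:R.
Proof.
move=> wp wm; pose x := rowend K w.
have xm : x m = - m%:R.
  rewrite /x /rowend (count_memPn _) ?sub0r //.
  by apply: contraTN wm => mw; apply/allPn; exists m; rewrite //= ltnn.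
have x_inj : injective x := rowend_inj wp.
pose t (i : 'I_m) := (x i - x m - 1) * \prod_(k < m | k != i) ((x i - x k - 1) / (x i - x k)).
transitivity (\sum_i t i).
  rewrite big_mkcond; apply: eq_bigr => i _; case: ifPn => [/andP[iw up]|].
    have xE k : rowend K (rem (i : nat) w) k = x k - (i == k :> nat)%:R.
      by rewrite /x (perm_rowend K (perm_to_rem iw)) rowend_cons addrK.
    rewrite /transition invf_div (bigD1 i) //= subrr add0r mul1r.
    rewrite big_mkcond big_ord_recr /= -big_mkcond /= neq_ltn ltn_ord orbT.
    rewrite !xE eqxx (ltn_eqF (ltn_ord i)) subr0 /t.
    rewrite prodf_div mulrA [X in _ = X / _]mulrC.
    congr (_ * _ / _); last 1 first.
    - apply: eq_bigr => k; rewrite eq_sym -val_eqE /= => /negPf ki.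
      by rewrite !xE ki subr0; ring.
    - apply: eq_bigr => k ki; have /negPf ik : i != k :> nat by rewrite eq_sym.
      by rewrite xE ik subr0 mulr1n; ring.
    - by rewrite mulr1n; ring.
  (* Row [i.+1] is as long as row [i], so the factor of [t i] at index [i.+1] is 0; when [i.+1 = m]
     this is the separate first factor. *)
  move=> H; have xS : x i.+1 = x i - 1.
    suff E : count_mem i.+1 w = count_mem (i : nat) w.
      by rewrite /x /rowend E -natr1; ring.
    apply/eqP; rewrite eqn_leq (ispart_mono wp) // leqNgt.
    move: H; have [iw|/count_memPn ->//] := boolP ((i : nat) \in w).
    by rewrite ispart_rem.
  rewrite /t; have := ltn_ord i; rewrite leq_eqVlt => /predU1P[mi|im].
    have -> : x m = x i - 1 by rewrite -xS mi.
    by rewrite subKr subrr mul0r.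
  rewrite (bigD1 (Ordinal im)) /= ?xS; last by rewrite -val_eqE /= eqn_leq ltnn.
  by rewrite subKr subrr !mul0r mulr0.
have -> : \sum_i t i = \sum_(i < m) x i * \prod_(k < m | k != i) ((x i - x k - 1) / (x i - x k))
   + (m%:R - 1) * \sum_(i < m) \prod_(k < m | k != i) ((x i - x k - 1) / (x i - x k)).
  rewrite mulr_sumr -big_split /=; apply: eq_bigr => i _.
  by rewrite -mulrDl /t xm; congr (_ * _); ring.
rewrite sum_shift_quotient // sum_shift_quotient_mul // sumrB -!natr_sum.
rewrite sum_count_mem // -(big_mkord predT (fun i => i)) bin2_sum.
have := mul_bin_diag m 1; rewrite bin1 => /(congr1 (fun k => k%:R : K)).
case: m {wm xm t} => [|m]; first by rewrite bin0n !subr0 mulr0 addr0.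
rewrite !natrM -[m.+1%:R]natr1 /= => E.
by rewrite -[RHS]addr0 -(subrr (2%:R * 'C(m.+1, 2)%:R)) -{1}E; ring.
Qed.

(* The quantity [transition * nlattice] does not depend on the removed corner, by
   [transition_exchange]; summing over corners, [sum_inv_transition] gives its value. *)
Lemma nlattice_cons m w i : ispart w -> all (ltn^~ m) w -> i \in w -> ispart (rem i w) ->
  (nlattice m w)%:R = (size w)%:R * transition K m (rem i w) i * (nlattice m (rem i w))%:R.
Proof.
have [k] := ubnP (size w); elim: k w i => // k IH w i wk wp wm iw up.
have rem_lt v j : all (ltn^~ m) v -> all (ltn^~ m) (rem j v).
  by move=> /allP H; apply/allP => x /mem_rem /H.
have w0 : w != [::] by apply: contraTneq iw => ->.
pose q := transition K m (rem i w) i * (nlattice m (rem i w))%:R.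
rewrite -mulrA -/q nlattice_rec // natr_sum -(sum_inv_transition wp wm) mulr_suml.
rewrite (bigID (fun j : 'I_m => ispart (rem (j : nat) w))) /=.
rewrite [X in _ + X]big1 ?addr0; last first.
  by move=> j /andP[_ /nlattice_eq0 ->].
apply: eq_bigr => j /andP[jw vp].
have wi := perm_to_rem iw; have wj := perm_to_rem jw.
have jvp : ispart ((j : nat) :: rem (j : nat) w) by rewrite -(perm_ispart wj).
have iup : ispart (i :: rem i w) by rewrite -(perm_ispart wi).
have rj0 := @transition_neq0 K m _ _ vp jvp.
apply: (mulfI rj0); rewrite mulVKf // /q.
have [<- //|ij] := eqVneq (j : nat) i.
have im : (i < m)%N := allP wm _ iw.
(* Both corners are removed in [v]: the induction hypothesis expresses the two [nlattice] values
   through that of [v], and the exchange relation identifies the results. *)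
pose v := rem i (rem (j : nat) w).
have ijw : i \in rem (j : nat) w.
  by move: iw; rewrite (perm_mem wj) inE eq_sym (negPf ij).
have jiw : (j : nat) \in rem i w.
  by move: jw; rewrite (perm_mem wi) inE (negPf ij).
have E1 : perm_eq (rem (j : nat) w) (i :: v) := perm_to_rem ijw.
have E2 : perm_eq (rem i w) ((j : nat) :: v).
  rewrite -(perm_cons i) -(permPl wi) (permPl wj).
  apply: (@perm_trans _ ((j : nat) :: i :: v)); first by rewrite perm_cons.
  exact/permPl/(perm_catCA [:: (j : nat)] [:: i]).
have E3 : perm_eq (rem (j : nat) (rem i w)) v.
  by rewrite -(perm_cons (j : nat)) -(permPr E2) perm_sym perm_to_rem.
have vpart : ispart v.
  move: up; rewrite (ispart_rem wp iw) (ispart_rem vp ijw).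
  have /seq.permP C := wj; rewrite !C /= (negPf ij) add0n.
  by apply: leq_ltn_trans; rewrite leq_addl.
have sz : size (rem i w) = size (rem (j : nat) w) by rewrite !size_rem.
have sk : (size (rem (j : nat) w) < k)%N by rewrite size_rem //; case: (w) wk w0.
rewrite (IH _ i) // ?rem_lt // (IH (rem i w) j) ?sz ?rem_lt // ?(perm_ispart E3) //.
rewrite -/v (perm_transition _ _ _ E3) (perm_nlattice _ E3).
rewrite (perm_transition _ _ _ E1) (perm_transition _ _ _ E2).
have := @transition_exchange K m v i j im (ltn_ord j).
rewrite eq_sym ij -(perm_ispart E1) -(perm_ispart E2) => /(_ isT vpart vp up).
move: (transition K m (i :: v) j) (transition K m (_ :: v) i) => b d E.
rewrite (_ : b * _ = (size (rem (j : nat) w))%:R * (nlattice m v)%:R *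
  (transition K m v i * b)); last by ring.
by rewrite E; ring.
Qed.

End Cotransition.

(** * Matrices over a finite group *)

Section GroupMatrices.
Variables (K : fieldType) (gT : finGroupType).
Local Notation D := #|{: gT}|.
Implicit Types (M N B : 'M[K]_D) (H : {group gT}) (x y g s : gT).

Definition gmx (f : gT -> gT -> K) : 'M[K]_D :=
  \matrix_(a, b) f (enum_val a) (enum_val b).

Definition entry M x y := M (enum_rank x) (enum_rank y).

Lemma gmxE f x y : entry (gmx f) x y = f x y.
Proof. by rewrite /entry mxE !enum_rankK. Qed.

Lemma entryP M N : (forall x y, entry M x y = entry N x y) -> M = N.
Proof.
move=> E; apply/matrixP => a b; have := E (enum_val a) (enum_val b).
by rewrite /entry !enum_valK.
Qed.

Lemma entryD M N x y : entry (M + N) x y = entry M x y + entry N x y.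
Proof. by rewrite /entry mxE. Qed.

Lemma entry_sum I (r : seq I) (P : pred I) (F : I -> 'M[K]_D) x y :
  entry (\sum_(i <- r | P i) F i) x y = \sum_(i <- r | P i) entry (F i) x y.
Proof. by rewrite /entry summxE. Qed.

Lemma entry_mul M N x y : entry (M *m N) x y = \sum_z entry M x z * entry N z y.
Proof.
rewrite /entry mxE (reindex (@enum_rank gT)) //=.
by exists enum_val => ? _; rewrite ?enum_rankK ?enum_valK.
Qed.

Lemma entry1 x y : entry 1%:M x y = (x == y)%:R.
Proof. by rewrite /entry mxE (inj_eq enum_rank_inj). Qed.

Lemma tr_entry M : \tr M = \sum_x entry M x x.
Proof.
rewrite /mxtrace (reindex (@enum_rank gT)) //=.
by exists enum_val => ? _; rewrite ?enum_rankK ?enum_valK.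
Qed.

Definition rmulmx s := gmx (fun x y => ((x * s)%g == y)%:R).

Lemma entry_rmulmxl s M x y : entry (rmulmx s *m M) x y = entry M (x * s)%g y.
Proof.
rewrite entry_mul (bigD1 (x * s)%g) //= gmxE eqxx mul1r big1 ?addr0 // => z.
by rewrite gmxE eq_sym => /negPf ->; rewrite mul0r.
Qed.

Lemma entry_rmulmxr s M x y : entry (M *m rmulmx s) x y = entry M x (y * s^-1)%g.
Proof.
rewrite entry_mul (bigD1 (y * s^-1)%g) //= gmxE mulgKV eqxx mulr1 big1 ?addr0 // => z zy.
by rewrite gmxE (canF_eq (mulgK s)) (negPf zy) mulr0.
Qed.

Lemma rmulmxM s t : rmulmx s *m rmulmx t = rmulmx (s * t)%g.
Proof. by apply: entryP => x y; rewrite entry_rmulmxl !gmxE mulgA. Qed.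

Lemma rmulmx1 : rmulmx 1%g = 1%:M.
Proof. by apply: entryP => x y; rewrite gmxE mulg1 entry1. Qed.

Lemma rmulmx_tr s : (rmulmx s)^T = rmulmx s^-1%g.
Proof.
apply: entryP => x y; rewrite {1}/entry mxE -/(entry _ _ _) !gmxE.
by rewrite (canF_eq (mulgK s)) eq_sym.
Qed.

(** Right multiplications by elements of the group algebra of [H]: the first clause makes an entry
    depend on [x^-1 * y] only, the second restricts the support to [H]. *)
Definition subalg H M :=
  (forall g x y, entry M (g * x)%g (g * y)%g = entry M x y) /\
  (forall x y, (x^-1 * y)%g \notin H -> entry M x y = 0).

Lemma subalg_rmulmx H s : s \in H -> subalg H (rmulmx s).
Proof.
move=> sH; split=> [g x y|x y]; rewrite !gmxE.
  by rewrite -mulgA (inj_eq (mulgI g)).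
by case: eqP => // <-; rewrite mulKg sH.
Qed.

Lemma subalg_sum H I (r : seq I) (P : pred I) (F : I -> 'M[K]_D) :
  (forall i, P i -> subalg H (F i)) -> subalg H (\sum_(i <- r | P i) F i).
Proof.
move=> HF; split=> [g x y|x y xy]; rewrite !entry_sum.
  by apply: eq_bigr => i /HF[->].
by apply: big1 => i /HF[_ ->].
Qed.

(** Commuting with all [lmulmx g] is the first clause of [subalg]; commuting with all [cosetmx H g],
    the diagonal projections onto left cosets of [H], is the second. *)
Let lmulmx g := gmx (fun x y => ((g * x)%g == y)%:R).
Let cosetmx H g := gmx (fun x y => ((x == y) && ((g^-1 * x)%g \in H))%:R).

Let comm_lmulmx M :
  (forall g, comm_mx M (lmulmx g)) <->
  (forall g x y, entry M (g * x)%g (g * y)%g = entry M x y).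
Proof.
have El g N x y : entry (lmulmx g *m N) x y = entry N (g * x)%g y.
  rewrite entry_mul (bigD1 (g * x)%g) //= gmxE eqxx mul1r big1 ?addr0 // => z.
  by rewrite gmxE eq_sym => /negPf ->; rewrite mul0r.
have Er g N x y : entry (N *m lmulmx g) x (g * y)%g = entry N x y.
  rewrite entry_mul (bigD1 y) //= gmxE eqxx mulr1 big1 ?addr0 // => z.
  by rewrite gmxE (inj_eq (mulgI g)) => /negPf ->; rewrite mulr0.
split=> [C g x y|C g]; first by rewrite -El -C Er.
by apply: entryP => x y; rewrite El -[y](mulKVg g) Er C.
Qed.

Let comm_cosetmx H M :
  (forall g, comm_mx M (cosetmx H g)) <->
  (forall x y, (x^-1 * y)%g \notin H -> entry M x y = 0).
Proof.
have El g N x y : entry (cosetmx H g *m N) x y = ((g^-1 * x)%g \in H)%:R * entry N x y.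
  rewrite entry_mul (bigD1 x) //= gmxE eqxx big1 ?addr0 // => z.
  by rewrite gmxE eq_sym => /negPf ->; rewrite mul0r.
have Er g N x y : entry (N *m cosetmx H g) x y = ((g^-1 * y)%g \in H)%:R * entry N x y.
  rewrite entry_mul (bigD1 y) //= gmxE eqxx mulrC big1 ?addr0 // => z.
  by rewrite gmxE => /negPf ->; rewrite mulr0.
split=> [C x y xy|C g].
  have := congr1 (fun B => entry B x y) (C x).
  by rewrite El Er (negPf xy) mulVg group1 mul0r mul1r.
apply: entryP => x y; rewrite El Er.
have [xy|/C ->] := boolP ((x^-1 * y)%g \in H); last by rewrite !mulr0.
by rewrite -(groupMr (g^-1 * x)%g xy) mulgA mulgK.
Qed.

(* [subalg H] is the commutant of a set of matrices, hence stable under bicommutants. *)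
Lemma subalg_bicommutant H (I : eqType) (r : seq I) (F : I -> 'M[K]_D) M :
  {in r, forall i, subalg H (F i)} ->
  (forall B, {in r, forall i, comm_mx (F i) B} -> comm_mx M B) -> subalg H M.
Proof.
move=> HF HM; split.
  by apply/comm_lmulmx => g; apply: HM => i /HF[+ _]; move/comm_lmulmx.
by apply/comm_cosetmx => g; apply: HM => i /HF[_]; move/comm_cosetmx.
Qed.

(** For [H = Sfix k] this is the projection E_k: it preserves traces and is linear on both sides
    over [subalg H]. *)
Definition condexp H M :=
  gmx (fun x y => if (x^-1 * y)%g \in H then entry M x y else 0).

Lemma condexpD H M N : condexp H (M + N) = condexp H M + condexp H N.
Proof.
apply: entryP => x y; rewrite entryD !gmxE entryD.
by case: ifP => _ //; rewrite addr0.
Qed.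

(** Where [B] is nonzero, [z^-1 * y] lies in [H], so [x^-1 * z] and [x^-1 * y] lie in [H]
    together. *)
Lemma condexp_mulr H M B : subalg H B -> condexp H (M *m B) = condexp H M *m B.
Proof.
case=> _ HB; apply: entryP => x y; rewrite entry_mul gmxE entry_mul.
case: ifP => xy; [|symmetry]; [apply: eq_bigr | apply: big1] => z _; rewrite gmxE.
  have [zy|/HB ->] := boolP ((z^-1 * y)%g \in H); last by rewrite !mulr0.
  by rewrite -(groupMr _ zy) mulgA mulgK xy.
have [zy|/HB ->] := boolP ((z^-1 * y)%g \in H); last by rewrite mulr0.
by rewrite -(groupMr _ zy) mulgA mulgK xy mul0r.
Qed.

Lemma condexp_mull H B M : subalg H B -> condexp H (B *m M) = B *m condexp H M.
Proof.
case=> _ HB; apply: entryP => x y; rewrite entry_mul gmxE entry_mul.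
case: ifP => xy; [|symmetry]; [apply: eq_bigr | apply: big1] => z _; rewrite gmxE.
  have [xz|/HB ->] := boolP ((x^-1 * z)%g \in H); last by rewrite !mul0r.
  by rewrite -(groupMl _ xz) mulgA mulgK xy.
have [xz|/HB ->] := boolP ((x^-1 * z)%g \in H); last by rewrite mul0r.
by rewrite -(groupMl _ xz) mulgA mulgK xy mulr0.
Qed.

Lemma tr_condexp H M : \tr (condexp H M) = \tr M.
Proof.
by rewrite !tr_entry; apply: eq_bigr => x _; rewrite gmxE mulVg group1.
Qed.

Lemma condexp_rmulmx H s : s \notin H -> condexp H (rmulmx s) = 0.
Proof.
move=> sH; apply: entryP => x y; rewrite !gmxE /entry mxE; case: ifP => //.
by case: eqP => // <-; rewrite mulKg (negPf sH).
Qed.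

Lemma condexp_scalar H a : condexp H a%:M = a%:M.
Proof.
apply: entryP => x y; rewrite gmxE /entry mxE (inj_eq enum_rank_inj).
by have [<-|_] := eqVneq x y; rewrite ?mulVg ?group1 //= if_same.
Qed.

(** For [h] in [H], either [h] is in [L] and conjugation by [s] fixes it, or the conjugate leaves
    [H], where [B] is 0. It serves for [Sfix k.+1], [Sfix k] and the transposition of [k] and
    [k.+1]. *)
Lemma condexp_conj H (L : {group gT}) s B : s^-1%g = s ->
    {in L, forall h, h \in H /\ (s * h * s)%g = h} ->
    {in H, forall h, (s * h * s)%g \in H -> h \in L} -> subalg H B ->
  condexp H (rmulmx s *m B *m rmulmx s) = condexp L B.
Proof.
move=> sV HL LH [Binv HB]; apply: entryP => x y.
rewrite !gmxE entry_rmulmxr entry_rmulmxl sV; set h := (x^-1 * y)%g.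
have Bh u v : entry B u v = entry B 1%g (u^-1 * v)%g by rewrite -[RHS](Binv u) mulg1 mulKVg.
have E : ((x * s)^-1 * (y * s) = s * h * s)%g by rewrite invMg sV !mulgA.
case: (boolP (h \in L)) => [hL|hL].
  by have [-> sh] := HL _ hL; rewrite Bh E sh -Bh.
case: ifP => // hH; apply: HB; rewrite E.
by apply: contra hL => /(LH _ hH).
Qed.

End GroupMatrices.

(** * Jucys-Murphy elements *)

Section DiagonalCalculus.
Variables (K : fieldType) (d : nat) (P : 'M[K]_d).
Hypothesis P_unit : P \in unitmx.
Implicit Types f g : 'I_d -> K.

Definition dcalc f := invmx P *m diag_mx (\row_a f a) *m P.

Lemma dcalcM f g : dcalc f *m dcalc g = dcalc (fun a => f a * g a).
Proof.
rewrite /dcalc !mulmxA mulmxK // -[_ *m _ *m diag_mx _]mulmxA mulmx_diag.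
by congr (_ *m diag_mx _ *m _); apply/rowP => a; rewrite !mxE.
Qed.

Lemma dcalcD f g : dcalc f + dcalc g = dcalc (fun a => f a + g a).
Proof.
rewrite /dcalc -mulmxDl -mulmxDr -raddfD.
by congr (_ *m diag_mx _ *m _); apply/rowP => a; rewrite !mxE.
Qed.

Lemma dcalcZ x f : x *: dcalc f = dcalc (fun a => x * f a).
Proof.
rewrite /dcalc scalemxAl scalemxAr -linearZ.
by congr (_ *m diag_mx _ *m _); apply/rowP => a; rewrite !mxE.
Qed.

Lemma eq_dcalc f g : f =1 g -> dcalc f = dcalc g.
Proof.
by move=> fg; congr (_ *m diag_mx _ *m _); apply/rowP => a; rewrite !mxE.
Qed.

Lemma dcalc_const x : dcalc (fun=> x) = x%:M.
Proof.
rewrite /dcalc -[x%:M]mulmx1 -[1%:M](mulVmx P_unit) mulmxA -scalar_mxC.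
congr (_ *m _ *m _); apply/matrixP => a b; by rewrite !mxE.
Qed.

Lemma dcalc_tr f : \tr (dcalc f) = \sum_a f a.
Proof.
rewrite /dcalc mxtrace_mulC mulmxA mulmxV // mul1mx mxtrace_diag.
by apply: eq_bigr => a _; rewrite mxE.
Qed.

Lemma dcalc_inj f g : dcalc f = dcalc g -> f =1 g.
Proof.
move=> /(congr1 (fun M => P *m M *m invmx P)); rewrite /dcalc.
rewrite !mulmxA mulmxV // !mul1mx !mulmxK // => /matrixP E a.
by have := E a a; rewrite !mxE eqxx.
Qed.

Lemma dcalc_char_poly f : char_poly (dcalc f) = \prod_a ('X - (f a)%:P).
Proof.
pose Q := map_mx (@polyC K) P.
have Qu : Q \in unitmx by rewrite map_unitmx.
have -> : char_poly (dcalc f) = char_poly (diag_mx (\row_a f a)).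
  rewrite /char_poly /char_poly_mx /dcalc !map_mxM map_invmx -/Q.
  rewrite -[X in X - _]mulmx1 -[1%:M](mulVmx Qu) mulmxA -scalar_mxC.
  by rewrite -mulmxBl -mulmxBr !det_mulmx mulrAC -det_mulmx mulVmx // det1 mul1r.
rewrite char_poly_trig ?diag_mx_is_trig //.
by apply: eq_bigr => a _; rewrite !mxE eqxx.
Qed.

Lemma dcalc_comm (I : Type) (Q : I -> Prop) (c : I -> 'I_d -> K) f B :
  (forall i, Q i -> comm_mx (dcalc (c i)) B) ->
  (forall a b, (forall i, Q i -> c i a = c i b) -> f a = f b) ->
  comm_mx (dcalc f) B.
Proof.
have E h : comm_mx (dcalc h) B <->
    forall a b, h a * (P *m B *m invmx P) a b = (P *m B *m invmx P) a b * h b.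
  have Eh : dcalc h = invmx P *m diag_mx (\row_a h a) *m P by [].
  split=> [C a b|C].
    have : diag_mx (\row_a h a) *m (P *m B *m invmx P) =
      (P *m B *m invmx P) *m diag_mx (\row_a h a).
      transitivity (P *m (dcalc h *m B) *m invmx P).
        by rewrite Eh !mulmxA mulmxV // mul1mx.
      by rewrite C Eh !mulmxA mulmxK.
    move: (P *m B *m invmx P) => Z /matrixP/(_ a b).
    by rewrite mul_diag_mx mul_mx_diag !mxE.
  have H : diag_mx (\row_a h a) *m (P *m B *m invmx P) =
      (P *m B *m invmx P) *m diag_mx (\row_a h a).
    move: C; move: (P *m B *m invmx P) => Z C.
    by apply/matrixP => a b; rewrite mul_diag_mx mul_mx_diag !mxE C.
  have := congr1 (fun M => invmx P *m M *m P) H.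
  by rewrite /comm_mx Eh !mulmxA mulmxKV // mulVmx // mul1mx.
move=> Hc Hf; apply/E => a b.
have [ab|] := eqVneq (f a) (f b); first by rewrite ab mulrC.
set x := (P *m _ *m _) a b; have [->|x0] := eqVneq x 0; first by rewrite mulr0 mul0r.
case/eqP; apply: Hf => i /Hc/E/(_ a b); rewrite -/x mulrC.
exact: mulfI.
Qed.

End DiagonalCalculus.

(** * Definition and relations of the Jucys-Murphy elements *)

Section JucysMurphy.
Variables (K : fieldType) (n : nat).
Local Notation G := 'S_n.+1.
Implicit Types (k l : nat) (s : G).

Definition Sfix k : {set G} := [set s : G | [forall i : 'I_n.+1, (k <= i)%N ==> (s i == i)]].

Lemma SfixP k s : reflect (forall i : 'I_n.+1, (k <= i)%N -> s i = i) (s \in Sfix k).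
Proof.
rewrite inE; apply: (iffP forallP) => H i; last by apply/implyP => /H ->.
by move: (H i) => /implyP + /[dup] => /[apply] /eqP.
Qed.

Lemma group_set_Sfix k : group_set (Sfix k).
Proof.
apply/group_setP; split=> [|s t /SfixP sk /SfixP tk].
  by apply/SfixP => i _; rewrite perm1.
by apply/SfixP => i ki; rewrite permM sk // tk.
Qed.
Canonical Sfix_group k := Group (group_set_Sfix k).

Lemma Sfix_ltn k s i : s \in Sfix k -> (s i < k)%N = (i < k)%N.
Proof.
move=> sk; apply/idP/idP; apply: contraTT; rewrite -!leqNgt => ki.
  by rewrite (SfixP _ _ sk).
by rewrite -[i](perm_inj (SfixP _ _ sk _ ki)).
Qed.

Lemma tperm_Sfix k (i j : 'I_n.+1) : (i < k)%N -> (j < k)%N -> tperm i j \in Sfix k.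
Proof.
by move=> ik jk; apply/SfixP => l kl; rewrite tpermD // neq_ltn (leq_trans _ kl).
Qed.

Definition jucys k : 'M[K]_#|{: G}| :=
  \sum_(i < n.+1 | (i < k)%N) rmulmx K (tperm i (inord k)).

Lemma jucys0 : jucys 0 = 0.
Proof. exact: big_pred0. Qed.

Lemma jucys_subalg k l : (k <= n)%N -> (k < l)%N -> subalg (Sfix_group l) (jucys k).
Proof.
move=> kn kl; apply: subalg_sum => i ik; apply: subalg_rmulmx.
by rewrite tperm_Sfix ?inordK // (ltn_trans ik).
Qed.

(** Conjugation by [s] fixes the point [k] and permutes the points below it, hence permutes the
    summands. *)
Lemma jucys_comm_rmulmx k s : (k <= n)%N -> s \in Sfix k -> comm_mx (jucys k) (rmulmx K s).
Proof.
move=> kn sk; rewrite /comm_mx mulmx_suml mulmx_sumr [RHS](reindex_inj (@perm_inj _ s)) /=.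
apply: eq_big => [i|i _]; first by rewrite Sfix_ltn.
rewrite !rmulmxM; congr (rmulmx _ _); rewrite (conjgC (tperm _ _)) tpermJ.
by rewrite [s (inord k)](SfixP _ _ sk) // inordK.
Qed.

Lemma jucys_comm k l : (k <= n)%N -> (l <= n)%N -> comm_mx (jucys k) (jucys l).
Proof.
move=> kn ln; wlog kl : k l kn ln / (k < l)%N.
  move=> W; have [kl|lk|->//] := ltngtP k l; first exact: W.
  exact/comm_mx_sym/W.
apply: comm_mx_sym; rewrite {2}/jucys; apply: comm_mx_sum => i ik.
by apply: jucys_comm_rmulmx; rewrite // tperm_Sfix ?inordK // (ltn_trans ik).
Qed.

(** Conjugation by the transposition [s] of [k] and [k.+1] sends the summands of [jucys k] to those
    of [jucys k.+1], except for [s] itself, which yields the identity. *)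
Lemma jucysS k : (k < n)%N ->
  rmulmx K (tperm (inord k) (inord k.+1)) *m jucys k.+1 =
  jucys k *m rmulmx K (tperm (inord k) (inord k.+1)) + 1%:M.
Proof.
move=> kn; set s := tperm _ _.
have ak : (inord k : 'I_n.+1) = k :> nat by rewrite (@inordK n) // ltnS ltnW.
have bk : (inord k.+1 : 'I_n.+1) = k.+1 :> nat by rewrite (@inordK n).
rewrite mulmx_sumr mulmx_suml (bigD1 (inord k)) /=; last by rewrite ak.
rewrite [LHS]addrC rmulmxM tperm2 rmulmx1; apply: (congr1 (fun M => M + 1%:M)).
apply: eq_big => [i|i /andP[ik ik']].
  by rewrite -val_eqE /= ak ltnS; case: ltngtP.
rewrite !rmulmxM; congr (rmulmx _ _).
have -> : tperm i (inord k.+1) = (tperm i (inord k) ^ s)%g.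
  rewrite tpermJ /s tpermL tpermD //; first by rewrite eq_sym.
  by rewrite -val_eqE /= bk gtn_eqF.
by rewrite conjgE mulKVg.
Qed.

Lemma jucys_sym k : (jucys k)^T = jucys k.
Proof.
rewrite /jucys raddf_sum; apply: eq_bigr => i _.
by rewrite /= rmulmx_tr tpermV.
Qed.

End JucysMurphy.

(** * Resolvents of the Jucys-Murphy elements *)

Lemma resolvent_commutation (K : fieldType) d (z : K) (X Y S Rx Ry : 'M[K]_d) :
    Rx *m X = z *: Rx - 1%:M -> Y *m Ry = z *: Ry - 1%:M -> S *m Y = X *m S + 1%:M ->
  S *m Ry = Rx *m S + Rx *m Ry.
Proof.
move=> HX HY HS; have L : Rx *m (S *m Y) *m Ry = z *: (Rx *m S *m Ry) - Rx *m S.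
  by rewrite mulmxA -mulmxA HY mulmxBr mulmx1 scalemxAr.
have : Rx *m (X *m S + 1%:M) *m Ry = z *: (Rx *m S *m Ry) - S *m Ry + Rx *m Ry.
  by rewrite mulmxDr mulmx1 mulmxDl mulmxA HX mulmxBl mul1mx mulmxBl -!scalemxAl.
rewrite -HS L => /eqP; rewrite -addrA (inj_eq (addrI _)) eqr_oppLR.
by rewrite opprD opprK => /eqP ->; rewrite subrK.
Qed.

(** The relation is used twice: multiplied by [S] on the left it gives [Ry = S Rx S + S Rx Ry], and
    after commuting [Rx] and [Ry] it applies again to [S Ry Rx]. *)
Lemma resolvent_conj (K : fieldType) d (S Rx Ry : 'M[K]_d) :
    S *m S = 1%:M -> Rx *m Ry = Ry *m Rx -> S *m Ry = Rx *m S + Rx *m Ry ->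
  Ry *m (1%:M - Rx *m Rx) = S *m Rx *m S + Rx *m S *m Rx.
Proof.
move=> SS C HS; rewrite mulmxBr mulmx1 -{1}[Ry]mul1mx -SS -mulmxA HS mulmxDr -addrA.
rewrite mulmxA; congr (_ + _); rewrite C mulmxA HS mulmxDl -addrA C.
by rewrite mulmxA subrr addr0.
Qed.

Section Resolvent.
Variables (K : fieldType) (n : nat).
Local Notation G := 'S_n.+1.
Local Notation D := #|{: G}|.
Variables (P : 'M[K]_D) (c : nat -> 'I_D -> K).
Hypothesis P_unit : P \in unitmx.
Hypothesis jucysE : forall k, (k <= n)%N -> jucys K n k = dcalc P (c k).

(** The latest eigenvalue comes first, to match the order of [contents]. *)
Fixpoint spectral_prefix k (a : 'I_D) : seq K :=
  if k is k'.+1 then c k' a :: spectral_prefix k' a else [::].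

Lemma eq_prefix k a b : (forall i, (i < k)%N -> c i a = c i b) ->
  spectral_prefix k a = spectral_prefix k b.
Proof.
by elim: k => //= k IH E; rewrite E // IH // => i ik; apply: E; apply: ltnW.
Qed.

(** By [dcalc_comm], such a matrix commutes with whatever commutes with [jucys 0], ...,
    [jucys (k - 1)]; these lie in [subalg], which is stable under bicommutants. *)
Lemma dcalc_subalg k (f : 'I_D -> K) : (k <= n.+1)%N ->
    (forall a b, (forall i, (i < k)%N -> c i a = c i b) -> f a = f b) ->
  subalg (Sfix_group n k) (dcalc P f).
Proof.
move=> kn Hf; apply: (@subalg_bicommutant _ _ _ nat (iota 0 k) (jucys K n)) => [i|B HB].
  rewrite mem_iota add0n => /= ik; apply: jucys_subalg => //.
  by rewrite -ltnS (leq_trans ik).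
apply: (@dcalc_comm _ _ _ P_unit nat (fun i => (i < k)%N) c) => // i ik.
by rewrite -jucysE; [apply: HB; rewrite mem_iota | rewrite -ltnS (leq_trans ik)].
Qed.

Let jm0 a : c 0 a = 0.
Proof.
apply: (@dcalc_inj _ _ P P_unit (c 0%N) (fun=> 0)).
by rewrite -jucysE // jucys0 dcalc_const // raddf0.
Qed.

Variable z : K.
Hypothesis z_c : forall k a, (k <= n)%N -> z - c k a != 0.
Hypothesis z_c1 : forall k a, (k <= n)%N -> (z - c k a) ^+ 2 - 1 != 0.

Definition resolvent k := dcalc P (fun a => (z - c k a)^-1).

Lemma resolvent_subalg k : (k <= n)%N -> subalg (Sfix_group n k.+1) (resolvent k).
Proof. by move=> kn; apply: dcalc_subalg => // a b ->. Qed.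

Lemma resolvent_intertwine k : (k < n)%N ->
  let S := rmulmx K (tperm (inord k) (inord k.+1) : G) in
  S *m resolvent k.+1 = resolvent k *m S + resolvent k *m resolvent k.+1.
Proof.
move=> kn S; have kn' := ltnW kn.
have Rx : resolvent k *m jucys K n k = z *: resolvent k - 1%:M.
  rewrite jucysE // /resolvent -scaleN1r -(dcalc_const P_unit 1) !dcalcZ dcalcM // dcalcD.
  by apply: eq_dcalc => a; field; apply: z_c.
have Ry : jucys K n k.+1 *m resolvent k.+1 = z *: resolvent k.+1 - 1%:M.
  rewrite jucysE // /resolvent -scaleN1r -(dcalc_const P_unit 1) !dcalcZ dcalcM // dcalcD.
  by apply: eq_dcalc => a; field; apply: z_c.
exact: resolvent_commutation Rx Ry (jucysS K kn).
Qed.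

(** The inverse of 1 - R_k^2, where R_k is [resolvent k]. *)
Let W k := dcalc P (fun a => (1 - (z - c k a)^-2)^-1).

Lemma resolventS k : (k < n)%N ->
  let S := rmulmx K (tperm (inord k) (inord k.+1) : G) in
  resolvent k.+1 = S *m resolvent k *m S *m W k + resolvent k *m S *m (resolvent k *m W k).
Proof.
move=> kn S; have kn' := ltnW kn; have I := resolvent_intertwine kn.
have SS : S *m S = 1%:M by rewrite /S rmulmxM tperm2 rmulmx1.
have C : resolvent k *m resolvent k.+1 = resolvent k.+1 *m resolvent k.
  by rewrite /resolvent !dcalcM //; apply: eq_dcalc => a; rewrite mulrC.
have E : resolvent k.+1 *m dcalc P (fun a => 1 - (z - c k a)^-2) =
    S *m resolvent k *m S + resolvent k *m S *m resolvent k.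
  have -> : dcalc P (fun a => 1 - (z - c k a)^-2) = 1%:M - resolvent k *m resolvent k.
    rewrite /resolvent -scaleN1r -(dcalc_const P_unit 1) dcalcM // dcalcZ dcalcD.
    by apply: eq_dcalc => a; rewrite mulN1r -invfM -expr2.
  exact: resolvent_conj SS C I.
rewrite (mulmxA (resolvent k *m S)) -mulmxDl -E -mulmxA /W dcalcM //.
rewrite (@eq_dcalc _ _ P _ (fun=> 1)) ?dcalc_const ?mulmx1 // => a.
have z0 := z_c a kn'; have z1 := z_c1 a kn'; rewrite mulfV //.
have -> : 1 - (z - c k a)^-2 = ((z - c k a) ^+ 2 - 1) / (z - c k a) ^+ 2 by field.
by rewrite mulf_neq0 // invr_eq0 expf_neq0.
Qed.

(* As the permutation [tperm k k.+1] is not in [Sfix k.+1], only the first summand of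
   [resolventS] contributes. *)
Lemma condexp_resolvent k : (k <= n)%N ->
  condexp (Sfix_group n k) (resolvent k) =
  dcalc P (fun a => z^-1 *
    \prod_(x <- spectral_prefix k a) ((z - x) ^+ 2 / ((z - x) ^+ 2 - 1))).
Proof.
elim: k => [|k IH] kn.
  rewrite /resolvent (@eq_dcalc _ _ P _ (fun=> z^-1)) => [|a]; last by rewrite jm0 subr0.
  rewrite [RHS](@eq_dcalc _ _ P _ (fun=> z^-1)) => [|a]; last by rewrite big_nil mulr1.
  by rewrite dcalc_const // condexp_scalar.
have kn' := ltnW kn; have SV := resolvent_subalg kn'.
have WV : subalg (Sfix_group n k.+1) (W k) by apply: dcalc_subalg => // a b ->.
set s := tperm (inord k) (inord k.+1) : G.
have ak : (inord k : 'I_n.+1) = k :> nat by rewrite inordK // ltnS ltnW.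
have bk : (inord k.+1 : 'I_n.+1) = k.+1 :> nat by rewrite inordK.
have sS : s \notin Sfix_group n k.+1.
  apply/negP => /SfixP/(_ (inord k.+1)); rewrite bk leqnn tpermR => /(_ isT).
  by move/(congr1 val); rewrite /= ak bk => /eqP; rewrite ltn_eqF.
have RWV : subalg (Sfix_group n k.+1) (resolvent k *m W k).
  rewrite /resolvent /W dcalcM //; apply: dcalc_subalg => // a b E; by rewrite E.
rewrite resolventS // condexpD (condexp_mulr _ WV) (condexp_mulr _ RWV) (condexp_mull _ SV).
rewrite condexp_rmulmx // mulmx0 mul0mx addr0.
(* Projecting the conjugated resolvent for [k.+1] amounts to projecting [resolvent k] for [k], so
   the induction hypothesis applies; [W k] supplies the new factor of the product. *)
rewrite (@condexp_conj _ _ _ (Sfix_group n k)) //.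
- rewrite IH // /W dcalcM //; apply: eq_dcalc => a /=.
  rewrite big_cons mulrA [RHS]mulrAC; congr (_ * _).
  have z0 := z_c a kn'; have z1 := z_c1 a kn'.
  by move: (z - c k a) z0 z1 => u u0 u1; field; rewrite u1.
- exact: tpermV.
- move=> h hk; have /SfixP hf := hk; split.
    by apply/SfixP => i ki; apply: hf; apply: ltnW.
  rewrite (conjgC s) /s tpermJ !hf ?ak ?bk ?leqnSn // -mulgA tperm2.
  by rewrite mulg1.
- move=> h /SfixP hf /SfixP/(_ (inord k.+1)); rewrite bk leqnn => /(_ isT).
  rewrite !permM tpermR => E; apply/SfixP => i; rewrite leq_eqVlt => /predU1P[ki|/hf//].
  have -> : i = inord k by apply: val_inj; rewrite /= ak.
  by apply: (@perm_inj _ s); rewrite E tpermL.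
Qed.

(** Trace of [resolvent k] against the spectral projection [F] of the prefix [v]. As [F] lies in
    [subalg] of [Sfix k], it passes through [condexp], which preserves the trace. *)
Lemma prefix_resolvent_sum k (v : seq K) : (k <= n)%N ->
  \sum_(a | spectral_prefix k a == v) (z - c k a)^-1 =
  #|[set a | spectral_prefix k a == v]|%:R *
    (z^-1 * \prod_(x <- v) ((z - x) ^+ 2 / ((z - x) ^+ 2 - 1))).
Proof.
move=> kn; pose F := dcalc P (fun a => (spectral_prefix k a == v)%:R).
have FV : subalg (Sfix_group n k) F.
  by apply: dcalc_subalg => [|a b E]; [exact: leqW | rewrite (eq_prefix E)].
have := tr_condexp (Sfix_group n k) (F *m resolvent k).
rewrite condexp_mull // condexp_resolvent // /F /resolvent !dcalcM // !dcalc_tr //.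
rewrite [LHS](bigID (fun a => spectral_prefix k a == v)) /= [X in _ + X]big1 ?addr0; last first.
  by move=> a /negPf ->; rewrite mul0r.
rewrite [RHS](bigID (fun a => spectral_prefix k a == v)) /=.
rewrite [X in _ = _ + X]big1 ?addr0; last first.
  by move=> a /negPf ->; rewrite mul0r.
rewrite [RHS](eq_bigr (fun a => (z - c k a)^-1)) => [<-|a ->]; last by rewrite mul1r.
rewrite (eq_bigr (fun=> z^-1 * \prod_(x <- v) ((z - x) ^+ 2 / ((z - x) ^+ 2 - 1)))).
  by rewrite sumr_const mulr_natl -cardsE.
by move=> a /eqP ->; rewrite eqxx mul1r.
Qed.

End Resolvent.

(** * Joint spectrum of the Jucys-Murphy elements *)

(** Each of these matrices is real and symmetric, so the spectral theorem diagonalises it; as they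
    commute, one basis serves for all. *)
Lemma jucys_codiagonalizable (C : numClosedFieldType) n :
  exists2 P, P \in unitmx & exists c, forall k, (k <= n)%N -> jucys C n k = dcalc P (c k).
Proof.
have [+ _] := codiagonalizableP [seq jucys C n k | k <- iota 0 n.+1].
case.
  split=> [f g /mapP[k + ->] /mapP[l + ->]|f /mapP[k _ ->]].
    by rewrite !mem_iota !add0n !ltnS => kn ln; apply: jucys_comm.
  have /orthomx_spectralP E : jucys C n k \is normalmx.
    apply: symmetric_normalmx.
      by apply/is_hermitianmxP; rewrite expr0 scale1r map_mx_id // jucys_sym.
    apply/mxOverP => a b; rewrite /jucys summxE; apply: rpred_sum => i _.
    by rewrite mxE; apply: realn.
  exists (spectralmx (jucys C n k)); first exact: spectral_unit.
  apply/similar_diagLR; first exact: spectral_unit.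
  by exists (spectral_diag (jucys C n k)); rewrite {1}E conjVmx // spectral_unit.
move=> P P_unit /allP H; exists P => //.
exists (fun k a => conjmx P (jucys C n k) a a) => k kn.
have /H /= /similar_diagPex[d /(similarLR P_unit) E] :
    jucys C n k \in [seq jucys C n k | k <- iota 0 n.+1].
  by apply: map_f; rewrite mem_iota add0n ltnS.
rewrite {1}E conjVmx // /dcalc; congr (_ *m diag_mx _ *m _); apply/rowP => a.
by rewrite [RHS]mxE E conjmxVK // mxE eqxx.
Qed.

Section Multiplicities.
Variables (K : numFieldType) (n : nat).
Local Notation G := 'S_n.+1.
Local Notation D := #|{: G}|.
Variables (P : 'M[K]_D) (c : nat -> 'I_D -> K).
Hypothesis P_unit : P \in unitmx.
Hypothesis jucysE : forall k, (k <= n)%N -> jucys K n k = dcalc P (c k).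
Implicit Types w u : seq nat.

(** The sum of [prefix_resolvent_sum] has poles at the next eigenvalues; [contents_resolvent] and
    [resolvent_pfrac] expand its value with poles at the row ends. Uniqueness of partial fractions
    equates the coefficients at [y]. *)
Lemma prefix_step k w y : (k <= n)%N -> ispart w -> all (ltn^~ n.+1) w -> size w = k ->
  #|[set a | (spectral_prefix c k a == contents K w) && (c k a == y)]|%:R =
  #|[set a | spectral_prefix c k a == contents K w]|%:R *
    \sum_(i < n.+1 | rowend K w i == y) transition K n.+1 w i.
Proof.
move=> kn wp wn wk; set N := #|[set a | spectral_prefix c k a == contents K w]|%:R : K.
(* The difference of the two expansions is one sum over eigenvector indices (left) and rows
   (right). *)
pose x t := match t with inl a => c k a | inr i => rowend K w (i : 'I_n.+1) end.
pose al t : K := match t with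
  | inl a => (spectral_prefix c k a == contents K w)%:R
  | inr i => - (N * transition K n.+1 w (i : 'I_n.+1)) end.
have [cs csP] : exists cs : seq K, forall i a, (i <= n)%N -> c i a \in cs.
  exists [seq c i a | i <- iota 0 n.+1, a <- enum 'I_D] => i a ni.
  by apply: (allpairs_f c); rewrite ?mem_iota ?mem_enum.
have [es esP] : exists es : seq K, forall i, (i < n.+1)%N -> - i.+1%:R \in es.
  exists [seq - i.+1%:R | i <- iota 0 n.+1] => i ni.
  by apply: (map_f (fun i => - i.+1%:R)); rewrite mem_iota.
have [rs rsP] : exists rs : seq K, forall i, (i < n.+2)%N -> rowend K w i \in rs.
  by exists [seq rowend K w i | i <- iota 0 n.+2] => i ni; rewrite map_f ?mem_iota.
(* [B] collects every [z] at which a denominator of the lemmas applied below could vanish. *)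
pose B := cs ++ [seq b - 1 | b <- cs] ++ [seq b + 1 | b <- cs] ++
  es ++ contents K w ++ [seq b - 1 | b <- contents K w] ++ rs.
have H z : z \notin B -> \sum_t al t / (z - x t) = 0.
  rewrite !mem_cat !negb_or => /and5P[z1 z2 z3 z4 /and3P[z5 z6 z7]].
  have z_cs i a (s : K -> K) : (i <= n)%N -> z \notin map s cs -> z != s (c i a).
    by move=> ni; apply: contraNneq => ->; rewrite map_f ?csP.
  have z_c i a : (i <= n)%N -> z - c i a != 0.
    by move=> ni; rewrite subr_eq0; apply: (z_cs i a id); rewrite ?map_id.
  have z_c1 i a : (i <= n)%N -> (z - c i a) ^+ 2 - 1 != 0.
    move=> ni; rewrite -[1](expr1n _ 2) subr_sqr mulf_neq0 //.
      by rewrite addrAC subr_eq0 subr_eq; apply: (z_cs i a (fun b => b + 1)).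
    rewrite (_ : _ + 1 = z - (c i a - 1)); last by ring.
    by rewrite subr_eq0; apply: (z_cs i a (fun b => b - 1)).
  rewrite big_sumType /=; under [X in _ + X]eq_bigr do rewrite mulNr -mulrA.
  rewrite sumrN -mulr_sumr -resolvent_pfrac ?wk //; last first.
    by move=> i; apply: contraNneq z7 => ->; apply: rsP.
  rewrite -contents_resolvent //; last first.
  - move=> b bw; split; first by rewrite subr_eq0; apply: contraNneq z5 => ->.
    rewrite (_ : _ + 1 = z - (b - 1)); last by ring.
    by rewrite subr_eq0; apply: contraNneq z6 => ->; apply: (map_f (fun b => b - 1)).
  - move=> i im; rewrite addr_eq0; apply: contraNneq z4 => ->; exact: esP.
  rewrite /N -(prefix_resolvent_sum P_unit jucysE z_c z_c1) //.
  rewrite [X in _ - X]big_mkcond -sumrB /= big1 // => a _.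
  by case: eqP => _; rewrite ?mul1r ?mul0r subrr.
have := pfrac_unique H y; rewrite big_sumType /= sumrN => /eqP; rewrite subr_eq0 => /eqP.
rewrite -mulr_sumr => <-; rewrite -sum1_card natr_sum.
rewrite [RHS]big_mkcond [LHS]big_mkcond; apply: eq_bigr => a _; rewrite inE.
by case: (_ == contents K w); case: (_ == y).
Qed.

(** Each letter multiplies the count by its transition probability, which [nlattice_cons] turns into
    a ratio of numbers of tableaux. *)
Lemma card_prefix k w : (k <= n.+1)%N -> lattice w -> all (ltn^~ n.+1) w -> size w = k ->
  #|[set a | spectral_prefix c k a == contents K w]|%:R =
  n.+1`!%:R / k`!%:R * (nlattice n.+1 w)%:R :> K.
Proof.
elim: k w => [|k IH] [|i u] //= kn.
  move=> _ _ _; rewrite /nlattice /= divr1 mulr1; congr _%:R.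
  rewrite -[RHS]card_Sn -[RHS](card_ord #|_|) cardsT.
  by apply: eq_card => a; rewrite !inE.
case/andP=> wp ul /andP[im um] [su]; have up := lattice_ispart ul.
have -> : [set a | c k a :: spectral_prefix c k a == rowend K u i :: contents K u] =
    [set a | (spectral_prefix c k a == contents K u) && (c k a == rowend K u i)].
  by apply/setP => a; rewrite !inE eqseq_cons andbC.
rewrite prefix_step // IH // 1?ltnW //.
rewrite (big_pred1 (Ordinal im)) => [|j]; last first.
  by rewrite (inj_eq (rowend_inj up)).
have iw : all (ltn^~ n.+1) (i :: u) by rewrite /= im.
rewrite (nlattice_cons K wp iw (mem_head _ _)) /= eqxx //.
rewrite su (factS k) natrM.
have f0 : k`!%:R != 0 :> K by rewrite pnatr_eq0 -lt0n fact_gt0.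
have k0 : k.+1%:R != 0 :> K by rewrite pnatr_eq0.
by move: (k`!%:R) (k.+1%:R) f0 k0 => f q f0 q0; field; rewrite f0 q0.
Qed.

(** If the next eigenvalue were not the row end of a row with nonzero transition, [prefix_step]
    would give an empty set of indices, yet [a] belongs to it. *)
Lemma spectral_prefix_contents k a : (k <= n.+1)%N ->
  exists w, [/\ lattice w, all (ltn^~ n.+1) w, size w = k &
    spectral_prefix c k a = contents K w].
Proof.
elim: k => [|k IH] kn; first by exists [::].
have [w [wl wn wk E]] := IH (ltnW kn); have wp := lattice_ispart wl.
have := prefix_step (c k a) kn wp wn wk.
have [i /andP[/eqP iE ri]|H] := pickP (fun i : 'I_n.+1 =>
  (rowend K w i == c k a) && (transition K n.+1 w i != 0)).
  move=> _; exists ((i : nat) :: w); rewrite /= E -iE wk ltn_ord wl andbT; split=> //.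
  by apply: contraNT ri => ip; rewrite transition_eq0 // ltnW.
rewrite big1 => [|i /eqP iE]; last first.
  by apply/eqP; have := H i; rewrite iE eqxx /= => /negbFE.
rewrite mulr0 => /eqP; rewrite pnatr_eq0 cards_eq0 => /eqP/setP/(_ a).
by rewrite !inE E !eqxx.
Qed.

End Multiplicities.

(** * Characteristic polynomial as a product over lattice words *)

Section WordEigenvalue.
Variable K : numFieldType.
Implicit Types w u : seq nat.

(* The head of [v] belongs to the largest entry, whose value is the length of [v]. *)
Fixpoint weighted_sum (v : seq K) : K :=
  if v is x :: v' then (x + 1) / (size v').+1%:R + weighted_sum v' else 0.

Definition word_eig n w : K := n%:R^-1 * weighted_sum (contents K w).

Lemma size_contents w : size (contents K w) = size w.
Proof. by elim: w => //= i u ->. Qed.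

Lemma contents_inj w u : lattice w -> lattice u -> contents K w = contents K u -> w = u.
Proof.
elim: w u => [|i w IH] [|j u] //= /andP[_ wl] /andP[_ ul] [E /(IH _ wl ul) wu].
by move: E; rewrite -wu => /(rowend_inj (lattice_ispart wl)) ->.
Qed.

Lemma OST_mxE n : OST_mx K n.+1 =
  n.+1%:R^-1 *: \sum_(k < n.+1) k.+1%:R^-1 *: (1%:M + jucys K n k).
Proof.
rewrite -[OST_mx K n.+1]/(gmx (@OST_trans K n.+1)); apply: entryP => x y.
have entryZ a (M : 'M[K]_#|{: 'S_n.+1}|) : entry (a *: M) x y = a * entry M x y.
  by rewrite /entry mxE.
have tE t : (t == x^-1 * y)%g = ((x * t)%g == y) by rewrite -(inj_eq (mulgI x)) mulKVg.
rewrite gmxE entryZ entry_sum mulr_sumr /OST_trans /OST.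
under eq_bigr do rewrite big_mkcondr /=.
rewrite (exchange_big_dep xpredT) //=; apply: eq_bigr => k _.
rewrite entryZ entryD entry1 entry_sum mulrA -invfM mulrDr mulr_sumr (bigD1 k) //=.
rewrite tperm1 tE mulg1; congr (_ + _); first by case: eqP; rewrite ?mulr1 ?mulr0.
apply: eq_big => [i|i /andP[ik ik']]; first by rewrite andbC -ltn_neqAle.
by rewrite gmxE inord_val tE; case: eqP; rewrite ?mulr1 ?mulr0.
Qed.

Lemma char_poly_OST_words n (P : 'M[K]_#|{: 'S_n.+1}|) c : P \in unitmx ->
    (forall k, (k <= n)%N -> jucys K n k = dcalc P (c k)) ->
  char_poly (OST_mx K n.+1) =
    \prod_(w <- lwords n.+1 n.+1) ('X - (word_eig n.+1 w)%:P) ^+ nlattice n.+1 w.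
Proof.
move=> P_unit jucysE.
have -> : OST_mx K n.+1 =
    dcalc P (fun a => n.+1%:R^-1 * weighted_sum (spectral_prefix c n.+1 a)).
  suff S k : (k <= n.+1)%N -> \sum_(i < k) i.+1%:R^-1 *: (1%:M + jucys K n i) =
      dcalc P (fun a => weighted_sum (spectral_prefix c k a)) by rewrite OST_mxE -dcalcZ S.
  elim: k => [|k IH] kn.
    by rewrite big_ord0 (dcalc_const P_unit 0) raddf0.
  rewrite big_ord_recr /= IH 1?ltnW // jucysE // -(dcalc_const P_unit 1) dcalcD dcalcZ dcalcD.
  apply: eq_dcalc => a /=; rewrite addrC; congr (_ + _).
  have -> : size (spectral_prefix c k a) = k by elim: (k) => //= j ->.
  by rewrite mulrC [1 + _]addrC.
rewrite dcalc_char_poly //.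
pose F w : {poly K} := 'X - (word_eig n.+1 w)%:P.
(* Exactly one word has the spectrum at [a] as its contents, so indices can be grouped by words;
   [card_prefix] at full length then gives the exponents. *)
transitivity (\prod_a \prod_(w <- lwords n.+1 n.+1 |
    spectral_prefix c n.+1 a == contents K w) F w).
  apply: eq_bigr => a _.
  have [w [wl wn wk E]] := spectral_prefix_contents P_unit jucysE a (leqnn _).
  have wL : w \in lwords n.+1 n.+1 by rewrite mem_lwords wk eqxx wn.
  rewrite E (big_rem w) // eqxx big1_seq => [|u /andP[/eqP Eu]].
    by rewrite /= mulr1.
  rewrite mem_rem_uniq ?lwords_uniq // inE mem_lwords => /andP[/eqP uw /and3P[_ _ ul]].
  by case: uw; apply: contents_inj.
rewrite (exchange_big_dep xpredT) //; apply: eq_big_seq => w.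
rewrite mem_lwords => /and3P[/eqP wk wn wl].
rewrite prodr_const -/(F w); congr (_ ^+ _).
have := card_prefix P_unit jucysE (leqnn _) wl wn wk.
rewrite mulfV ?mul1r; last by rewrite pnatr_eq0 -lt0n fact_gt0.
by move=> /eqP; rewrite eqr_nat cardsE => /eqP.
Qed.

End WordEigenvalue.


(** * Transfer of the formula between fields *)

Lemma map_contents (K L : numFieldType) (f : {rmorphism K -> L}) w :
  contents L w = [seq f x | x <- contents K w].
Proof. by elim: w => //= i u ->; rewrite rmorphB !rmorph_nat. Qed.

Lemma rmorph_word_eig (K L : numFieldType) (f : {rmorphism K -> L}) n w :
  f (word_eig K n w) = word_eig L n w.
Proof.
rewrite /word_eig rmorphM fmorphV rmorph_nat (map_contents f); congr (_ * _).
elim: (contents K w) => [|x v IH] /=; first exact: rmorph0.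
by rewrite rmorphD fmorph_div rmorphD rmorph1 rmorph_nat IH size_map.
Qed.

Lemma map_OST_mx (K L : numFieldType) (f : {rmorphism K -> L}) n :
  map_mx f (OST_mx K n) = OST_mx L n.
Proof.
apply/matrixP => a b; rewrite !mxE /OST_trans /OST rmorph_sum; apply: eq_bigr => i _.
by rewrite rmorph_sum; apply: eq_bigr => j _; rewrite fmorphV rmorphM !rmorph_nat.
Qed.

Lemma map_words_poly (K L : numFieldType) (f : {rmorphism K -> L}) n m :
  map_poly f (\prod_(w <- lwords m m) ('X - (word_eig K n w)%:P) ^+ nlattice m w) =
  \prod_(w <- lwords m m) ('X - (word_eig L n w)%:P) ^+ nlattice m w.
Proof.
rewrite rmorph_prod; apply: eq_bigr => w _.
by rewrite rmorphXn /= map_polyXsubC rmorph_word_eig.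
Qed.

(* The Jucys-Murphy matrices are diagonalised over [algC]; both sides have rational
   coefficients. *)
Lemma char_poly_OST (K : numFieldType) n :
  char_poly (OST_mx K n.+1) =
    \prod_(w <- lwords n.+1 n.+1) ('X - (word_eig K n.+1 w)%:P) ^+ nlattice n.+1 w.
Proof.
suff Q : char_poly (OST_mx rat n.+1) =
    \prod_(w <- lwords n.+1 n.+1) ('X - (word_eig rat n.+1 w)%:P) ^+ nlattice n.+1 w.
  by rewrite -(map_OST_mx (ratr : {rmorphism rat -> K})) -map_char_poly Q map_words_poly.
have [P P_unit [c jucysE]] := jucys_codiagonalizable algC n.
apply: (@map_poly_inj _ _ (ratr : {rmorphism rat -> algC})).
by rewrite map_words_poly map_char_poly map_OST_mx (char_poly_OST_words P_unit jucysE).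
Qed.

(** * Standard Young tableaux as lattice words *)

Section History.
Implicit Types (r : nat -> nat) (i j k : nat).

Fixpoint history r k : seq nat := if k is k'.+1 then r k' :: history r k' else [::].

Lemma size_history r k : size (history r k) = k.
Proof. by elim: k => //= k ->. Qed.

Lemma eq_history r r' k : (forall i, (i < k)%N -> r i = r' i) -> history r k = history r' k.
Proof.
by elim: k => //= k IH E; rewrite E // IH // => i ik; apply: E; apply: ltnW.
Qed.

Lemma history_eq r r' k : history r k = history r' k -> forall i, (i < k)%N -> r i = r' i.
Proof.
elim: k => //= k IH [E /IH H] i; rewrite ltnS leq_eqVlt => /predU1P[->//|]; exact: H.
Qed.

Lemma history_rev w : history (nth 0%N (rev w)) (size w) = w.
Proof.
elim: w => //= i u IH; rewrite rev_cons nth_rcons size_rev ltnn eqxx; congr (_ :: _).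
by rewrite -[RHS]IH; apply: eq_history => j ju; rewrite nth_rcons size_rev ju.
Qed.

Lemma all_history (p : pred nat) r k : all p (history r k) = [forall i : 'I_k, p (r i)].
Proof.
elim: k => [|k IH] /=; first by apply/esym/forallP => -[].
rewrite IH; apply/andP/forallP => [[pk /forallP H] i|H].
  by have := ltn_ord i; rewrite ltnS leq_eqVlt => /predU1P[->//|ik]; apply: (H (Ordinal ik)).
by split; [exact: (H ord_max) | apply/forallP => i; exact: (H (widen_ord (leqnSn k) i))].
Qed.

Lemma lattice_history r k :
  lattice (history r k) <-> forall j, (j <= k)%N -> ispart (history r j).
Proof.
elim: k => [|k IH] /=; first by split=> // _ [].
split=> [/andP[wp /IH H] j|H]; last first.
  by apply/andP; split; [exact: (H k.+1) | apply/IH => j jk; apply/H/ltnW].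
by rewrite leq_eqVlt => /predU1P[->//|]; exact: H.
Qed.

Lemma count_history_mono r i j k : (j <= k)%N ->
  (count_mem i (history r j) <= count_mem i (history r k))%N.
Proof.
move/subnK <-; elim: (k - j)%N => //= d IH.
by rewrite (leq_trans IH) // leq_addl.
Qed.

Lemma count_history_lt r j k : (j < k)%N ->
  (count_mem (r j) (history r j) < count_mem (r j) (history r k))%N.
Proof.
by move=> jk; apply: leq_trans (count_history_mono r (r j) jk); rewrite /= eqxx.
Qed.

(** The length of row [i] grows by single boxes, so some step takes it from [j] to [j.+1]. *)
Lemma count_history_hit r i j k : (j < count_mem i (history r k))%N ->
  exists2 l, (l < k)%N & r l = i /\ count_mem i (history r l) = j.
Proof.
elim: k => //= k IH; have [ri|ri] := eqVneq (r k) i; last first.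
  by rewrite add0n => /IH[l lk H]; exists l => //; apply: ltnW.
rewrite add1n ltnS leq_eqVlt => /predU1P[->|/IH[l lk H]]; first by exists k.
by exists l => //; apply: ltnW.
Qed.

Lemma weighted_sum_history (K : numFieldType) r k :
  weighted_sum (contents K (history r k)) =
  \sum_(j < k) ((count_mem (r j) (history r j))%:R - (r j)%:R + 1) / j.+1%:R.
Proof.
elim: k => [|k IH] /=; first by rewrite big_ord0.
by rewrite big_ord_recr /= IH size_contents size_history addrC.
Qed.

End History.

(** * The bijection between tableaux of a shape and its lattice words *)

Section Tableaux.
Variables (n : nat) (la : intpart n).
Implicit Types (b c : box la) (T : syt la).

Lemma box_eqP b c : box_row b = box_row c -> box_col b = box_col c -> b = c.
Proof.
by move=> r1 c1; apply: val_inj; rewrite [LHS]surjective_pairing [RHS]surjective_pairing;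
   congr (_, _).
Qed.

Lemma ex_box_at T (k : 'I_n) : exists b, val T b == k.
Proof.
have /and3P[/forallP/(_ k)/cards1P[b E] _ _] := valP T.
by exists b; have := set11 b; rewrite -E inE.
Qed.

Definition box_at T k := xchoose (ex_box_at T k).

Lemma box_atK T : cancel (box_at T) (val T).
Proof. by move=> k; apply/eqP/(xchooseP (ex_box_at T k)). Qed.

Lemma syt_inj T : injective (val T).
Proof.
have /and3P[/forallP H _ _] := valP T; move=> b c E.
have /cards1P[d /setP F] := H (val T b).
by have := F b; have := F c; rewrite !inE -E eqxx => /esym/eqP -> /esym/eqP ->.
Qed.

Lemma val_box_atK T : cancel (val T) (box_at T).
Proof. by move=> b; apply: (@syt_inj T); rewrite box_atK. Qed.

Definition row_of_entry T (k : nat) : nat :=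
  if insub k is Some k' then box_row (box_at T k') : nat else 0%N.

Lemma row_of_entryE T (k : 'I_n) : row_of_entry T k = box_row (box_at T k).
Proof. by rewrite /row_of_entry valK. Qed.

Definition word_of_syt T := history (row_of_entry T) n.

(* [entry_at T i j] is [n] outside the diagram. *)
Definition entry_at T (i j : 'I_n) : nat :=
  if insub (i, j) is Some b then val T b : nat else n.

Lemma entry_atE T b : entry_at T (box_row b) (box_col b) = val T b.
Proof. by rewrite /entry_at /box_row /box_col -surjective_pairing valK. Qed.

Lemma entry_at_lt T i j k : (entry_at T i j < k)%N -> (k <= n)%N ->
  exists b, [/\ box_row b = i, box_col b = j & (val T b < k)%N].
Proof.
rewrite /entry_at; case: insubP => [b bin bE Tk _|_ nk kn]; last first.
  by have := leq_trans nk kn; rewrite ltnn.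
by exists b; rewrite /box_row /box_col bE.
Qed.

Lemma entry_at_inside T (i j : 'I_n) : (entry_at T i j < n)%N = (j < val la i)%N.
Proof.
rewrite /entry_at; case: insubP => [b bin _|/negPf]; rewrite /= ?ltnn //.
by rewrite ltn_ord; move: bin => /= ->.
Qed.

(** With [entry_at_col], this makes the boxes with entry below [k] a Young diagram; the value [n]
    outside the shape lets one inequality also express membership. *)
Lemma entry_at_row T (i j j' : 'I_n) k : (j' <= j)%N ->
  (entry_at T i j < k)%N -> (k <= n)%N -> (entry_at T i j' < k)%N.
Proof.
rewrite leq_eqVlt => /predU1P[/val_inj->//|jj] H kn.
have [b [bi bj bk]] := entry_at_lt H kn.
have := entry_at_inside T i j; rewrite (leq_trans H kn) => /esym jl.
have := entry_at_inside T i j'; rewrite (ltn_trans jj jl) => H'.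
have [b' [bi' bj' _]] := entry_at_lt H' (leqnn n).
rewrite -bi' -bj' entry_atE; apply: leq_ltn_trans bk.
have /and3P[_ /forallP/(_ b')/forallP/(_ b) + _] := valP T.
by rewrite bi bi' eqxx bj bj' jj => /ltnW.
Qed.

Lemma entry_at_col T (i i' j : 'I_n) k : (i' <= i)%N ->
  (entry_at T i j < k)%N -> (k <= n)%N -> (entry_at T i' j < k)%N.
Proof.
rewrite leq_eqVlt => /predU1P[/val_inj->//|ii] H kn.
have [b [bi bj bk]] := entry_at_lt H kn.
have := entry_at_inside T i j; rewrite (leq_trans H kn) => /esym jl.
have /andP[/forallP/(_ i')/forallP/(_ i)/implyP/(_ (ltnW ii)) lai _] := valP la.
have := entry_at_inside T i' j; rewrite (leq_trans jl lai) => H'.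
have [b' [bi' bj' _]] := entry_at_lt H' (leqnn n).
rewrite -bi' -bj' entry_atE; apply: leq_ltn_trans bk.
have /and3P[_ _ /forallP/(_ b')/forallP/(_ b)] := valP T.
by rewrite bi bi' bj bj' eqxx ii => /ltnW.
Qed.

Lemma count_row T (i : 'I_n) k : (k <= n)%N ->
  count_mem (i : nat) (history (row_of_entry T) k) = #|[set j | (entry_at T i j < k)%N]|.
Proof.
elim: k => [|k IH] kn /=.
  by apply/esym/eqP; rewrite cards_eq0; apply/eqP/setP => j; rewrite !inE.
rewrite IH 1?ltnW //; pose k' := Ordinal kn; pose b := box_at T k'.
have bk : val T b = k' := box_atK T k'.
rewrite (row_of_entryE T k') -/b.
(* The entry [k] occupies the single box [b], so the two sets of columns differ only when [b] is in
   row [i]. *)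
have other j : (entry_at T i j == k) = (box_row b == i) && (box_col b == j).
  apply/eqP/andP => [E|[/eqP <- /eqP <-]]; last by rewrite entry_atE bk.
  have H : (entry_at T i j < n)%N by rewrite E.
  have [c [ci cj _]] := entry_at_lt H (leqnn n).
  have -> : b = c; last by rewrite ci cj !eqxx.
  by apply: (@syt_inj T); rewrite bk; apply: val_inj; rewrite /= -entry_atE ci cj E.
have step j : (entry_at T i j < k.+1)%N =
    (box_row b == i) && (box_col b == j) || (entry_at T i j < k)%N.
  by rewrite ltnS leq_eqVlt other.
have [bi|bi] := eqVneq (box_row b) i.
  have bE : entry_at T i (box_col b) = k by rewrite -bi entry_atE bk.
  rewrite bi eqxx [RHS](cardsD1 (box_col b)) inE bE ltnSn; congr (_ + _)%N.
  apply: eq_card => j; rewrite !inE step bi eqxx /= [box_col b == j]eq_sym.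
  by have [->|_] := eqVneq j (box_col b); rewrite ?bE ?ltnn.
rewrite -val_eqE /= in bi *; rewrite (negPf bi) add0n; apply: eq_card => j.
by rewrite !inE step -val_eqE /= (negPf bi).
Qed.

Lemma card_lower (A : {set 'I_n}) m : (m <= n)%N ->
  (forall j : 'I_n, (j \in A) = (j < m)%N) -> #|A| = m.
Proof.
move=> mn HA; transitivity #|[set widen_ord mn j | j in 'I_m]|.
  apply: eq_card => j; rewrite HA; apply/idP/imsetP => [jm|[l _ ->]].
    by exists (Ordinal jm) => //; apply: val_inj.
  exact: (ltn_ord l).
by rewrite card_imset ?card_ord // => x y /(congr1 val) /= /val_inj.
Qed.

(** When [k] is inserted, its row holds exactly the boxes to its left; thus the row end read from
    the word is the content of the box. *)
Lemma count_box_at T (k : 'I_n) :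
  count_mem (row_of_entry T k) (history (row_of_entry T) k) = box_col (box_at T k).
Proof.
rewrite row_of_entryE count_row ?(ltnW (ltn_ord k)) //; set b := box_at T k.
have bE : entry_at T (box_row b) (box_col b) = k by rewrite entry_atE box_atK.
apply: card_lower => [|j]; first exact/ltnW/ltn_ord.
rewrite inE; apply/idP/idP => [jk|jb].
  rewrite ltnNge; apply/negP => /(entry_at_row)/(_ jk (ltnW (ltn_ord k))).
  by rewrite bE ltnn.
have := entry_at_row (ltnW jb) (_ : (entry_at T (box_row b) (box_col b) < k.+1)%N) (ltn_ord k).
rewrite bE ltnSn ltnS leq_eqVlt => /(_ isT) /predU1P[E|//].
have H : (entry_at T (box_row b) j < n)%N by rewrite E.
have [c [cb cj _]] := entry_at_lt H (leqnn n).
suff cbE : c = b by move: jb; rewrite -cj cbE ltnn.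
by apply: (@syt_inj T); apply: val_inj; rewrite /= -!entry_atE cb cj E bE.
Qed.

Lemma count_word T (i : 'I_n) : count_mem (i : nat) (word_of_syt T) = val la i.
Proof.
rewrite count_row //; apply: card_lower; first by rewrite -ltnS.
by move=> j; rewrite inE entry_at_inside.
Qed.

Lemma lattice_word T : lattice (word_of_syt T).
Proof.
apply/lattice_history => k kn; apply/ispartP => i.
have [iSn|] := ltnP i.+1 n; last first.
  move=> ni; rewrite (count_memPn _) //; apply/negP => ih.
  have : all (ltn^~ n) (history (row_of_entry T) k).
    rewrite all_history; apply/forallP => j.
    by have jn := leq_trans (ltn_ord j) kn; rewrite (row_of_entryE T (Ordinal jn)) /= ltn_ord.
  by move/allP/(_ _ ih); rewrite /= ltnNge ni.
have iN := ltnW iSn.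
rewrite (count_row T (Ordinal iSn) kn) (count_row T (Ordinal iN) kn).
(* The boxes filled so far are closed upwards in each column. *)
apply: subset_leq_card; apply/subsetP => j; rewrite !inE => H.
by apply: entry_at_col H kn => /=.
Qed.

Lemma word_lwords T : word_of_syt T \in lwords n n.
Proof.
rewrite mem_lwords size_history eqxx lattice_word andbT all_history.
by apply/forallP => k; rewrite row_of_entryE /= ltn_ord.
Qed.

(** The letter of an entry gives its row, and the number of earlier equal letters gives its
    column. *)
Lemma word_inj : injective word_of_syt.
Proof.
move=> T U E; have R := history_eq E; apply: val_inj; apply/ffunP => b.
suff E2 : b = box_at U (val T b) by rewrite [in RHS]E2 box_atK.
rewrite -{1}(val_box_atK T b); set k := val T b; apply: box_eqP; apply: val_inj => /=.
  by rewrite -!row_of_entryE R.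
rewrite -!count_box_at R //; congr (count_mem _ _); apply: eq_history => i ik.
by rewrite R // (ltn_trans ik).
Qed.

Lemma word_surj w : w \in lwords n n -> (forall i : 'I_n, count_mem (i : nat) w = val la i) ->
  exists T, word_of_syt T = w.
Proof.
rewrite mem_lwords => /and3P[/eqP wn wlt wl] wla.
pose r := nth 0%N (rev w); have wE : w = history r n by rewrite -{1}(history_rev w) wn.
have rn k : (k < n)%N -> (r k < n)%N.
  by move=> kn; have := wlt; rewrite wE all_history => /forallP/(_ (Ordinal kn)).
have part k : (k <= n)%N -> ispart (history r k).
  by move: wl; rewrite wE => /lattice_history H; exact: H.
pose at_box (k : 'I_n) b := (r k == box_row b) && (count_mem (r k) (history r k) == box_col b).
have ex b : exists k, at_box k b.
  have : (box_col b < count_mem (box_row b : nat) (history r n))%N.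
    by rewrite -wE wla; exact: (valP b).
  case/count_history_hit => k kn [rk ck]; exists (Ordinal kn).
    by rewrite /at_box /= rk ck !eqxx.
(* A box is filled with the step at which its row reaches it. *)
pose t : {ffun box la -> 'I_n} := [ffun b => xchoose (ex b)].
have tP b : r (t b) = box_row b /\ count_mem (box_row b : nat) (history r (t b)) = box_col b.
  by rewrite ffunE; have /andP[/eqP <- /eqP <-] := xchooseP (ex b).
have lt_count k l : (k < l)%N ->
    (count_mem (r k) (history r k) < count_mem (r k) (history r l))%N.
  exact: count_history_lt.
have rowlt b c : box_row b = box_row c -> (box_col b < box_col c)%N -> (t b < t c)%N.
  move=> bc; have [rb cb] := tP b; have [rc cc] := tP c; rewrite -cb -cc bc.
  by apply: contraTT; rewrite -!leqNgt; apply: count_history_mono.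
have t_syt : is_syt t.
  apply/and3P; split.
  - apply/forallP => k; apply/cards1P.
    have rk := rn _ (ltn_ord k).
    have ck : (count_mem (r k) (history r k) < val la (Ordinal rk))%N.
      rewrite -wla /= wE; exact: lt_count.
    have ckn : (count_mem (r k) (history r k) < n)%N by apply: leq_trans ck _; rewrite -ltnS.
    pose b0 : box la := exist _ (Ordinal rk, Ordinal ckn) ck.
    exists b0; apply/setP => b; rewrite !inE.
    have [rb cb] := tP b; apply/eqP/eqP => [E|->].
      apply: box_eqP; apply: ord_inj => /=; first by rewrite -rb E.
      by rewrite -cb -rb E.
    (* Two steps with the same letter and the same earlier count of it coincide, as the count grows
       after each occurrence. *)
    have [rb' cb'] := tP b0; apply: ord_inj; have [H|H|//] := ltngtP (t b0) k.
      by have := lt_count _ _ H; rewrite rb' cb' /= ltnn.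
    by have := lt_count _ _ H; move: cb' => /= ->; rewrite ltnn.
  - apply/forallP => b; apply/forallP => c; apply/implyP => /eqP bc; apply/implyP.
    exact: rowlt.
  - apply/forallP => b; apply/forallP => c; apply/implyP => /eqP bc; apply/implyP => rbc.
    have [rb cb] := tP b; have [rc cc] := tP c.
    (* If the lower box [c] came first, then at step [t b] its row would be longer than the row of
       [b] above it. *)
    have [//|tcb|/val_inj E] := ltngtP (t b) (t c); last by move: rbc; rewrite -rb -rc E ltnn.
    have := count_history_lt r tcb; rewrite rc cc -bc -cb ltnNge => /negP[].
    exact: ispart_mono (part _ (ltnW (ltn_ord (t b)))) (ltnW rbc).
exists (exist _ t t_syt); rewrite wE; apply: eq_history => k kn.
rewrite (row_of_entryE _ (Ordinal kn)); set b := box_at _ _.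
have [<- _] := tP b; congr (r _).
by have /(congr1 val) := box_atK (exist _ t t_syt) (Ordinal kn).
Qed.

Lemma eig_word (R : numFieldType) T : eig R T = word_eig R n (word_of_syt T).
Proof.
rewrite /eig /word_eig weighted_sum_history; congr (_ * _).
rewrite (reindex (box_at T)) /=; last first.
  by exists (val T) => ? _; rewrite ?box_atK ?val_box_atK.
by apply: eq_bigr => k _; rewrite box_atK count_box_at row_of_entryE.
Qed.

Definition has_shape w := [forall i : 'I_n, count_mem (i : nat) w == val la i :> nat].

Lemma perm_words : perm_eq [seq word_of_syt T | T : syt la] [seq w <- lwords n n | has_shape w].
Proof.
apply: uniq_perm.
- by rewrite map_inj_uniq ?enum_uniq //; apply: word_inj.
- by rewrite filter_uniq ?lwords_uniq.
move=> w; rewrite mem_filter; apply/mapP/andP => [[T _ ->]|[/forallP wla wl]].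
  by split; [apply/forallP => i; rewrite count_word | exact: word_lwords].
have [T <-] := word_surj wl (fun i => eqP (wla i)).
by exists T; rewrite ?mem_enum.
Qed.

Lemma dim_part_nlattice w : w \in lwords n n -> has_shape w -> dim_part la = nlattice n w.
Proof.
rewrite mem_lwords => /and3P[/eqP wn wlt _] /forallP ws.
rewrite /dim_part cardE -(size_map word_of_syt) (perm_size perm_words) size_filter /nlattice wn.
apply: eq_in_count => u; rewrite mem_lwords => /and3P[_ ult _].
apply/forallP/idP => [us|/seq.permP wu i]; last by rewrite -wu.
rewrite /perm_eq; apply/allP => i; rewrite mem_cat => iwu /=.
have im : (i < n)%N by case/orP: iwu => [/(allP wlt)|/(allP ult)].
by rewrite (eqP (us (Ordinal im))) (eqP (ws (Ordinal im))).
Qed.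

End Tableaux.

Lemma has_shape_exists n w : w \in lwords n n ->
  exists2 la : intpart n, has_shape la w & forall mu : intpart n, has_shape mu w -> mu = la.
Proof.
rewrite mem_lwords => /and3P[/eqP wn wlt /lattice_ispart wp].
have le i : (count_mem i w < n.+1)%N by rewrite ltnS -wn count_size.
pose l : {ffun 'I_n -> 'I_n.+1} := [ffun i : 'I_n => Ordinal (le i)].
have lP : is_intpart l.
  apply/andP; split.
    apply/forallP => i; apply/forallP => j; apply/implyP => ij; rewrite !ffunE /=.
    exact: ispart_mono.
  apply/eqP; transitivity (size w); last exact: wn.
  by rewrite -(sum_count_mem wlt); apply: eq_bigr => i _; rewrite ffunE.
exists (exist _ l lP); first by apply/forallP => i; rewrite /= ffunE.
move=> mu /forallP H; apply: val_inj; apply/ffunP => i; apply: ord_inj.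
by rewrite -(eqP (H i)) /= ffunE.
Qed.

(** Each lattice word has exactly one shape, so grouping the words by shape covers each of them
    once. *)
Lemma prod_syt (R : numFieldType) n :
  \prod_(la : intpart n) \prod_(T : syt la) ('X - (eig R T)%:P) ^+ dim_part la =
  \prod_(w <- lwords n n) ('X - (word_eig R n w)%:P) ^+ nlattice n w.
Proof.
pose F w : {poly R} := ('X - (word_eig R n w)%:P) ^+ nlattice n w.
transitivity (\prod_(la : intpart n) \prod_(w <- lwords n n | has_shape la w) F w).
  apply: eq_bigr => la _.
  rewrite -[RHS]big_filter -(perm_big _ (perm_words la)) big_map big_enum /=.
  apply: eq_bigr => T _; rewrite eig_word /F (dim_part_nlattice (word_lwords T)) //.
  by apply/forallP => i; rewrite count_word.
rewrite (exchange_big_dep xpredT) //; apply: eq_big_seq => w wL.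
have [la laP laU] := has_shape_exists wL.
rewrite (big_pred1 la) // => mu; apply/idP/eqP => [/laU//|->//].
Qed.

Theorem theorem3p1p3 (R : numFieldType) (n : nat) (n_gt0 : (0 < n)%N) :
  char_poly (OST_mx R n) =
    \prod_(la : intpart n) \prod_(T : syt la)
       ('X - (eig R T)%:P) ^+ dim_part la.
Proof. by case: n n_gt0 => // n _; rewrite char_poly_OST prod_syt. Qed.
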